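(* Let $K^*\in\mathcal{K}$ denote the global optimum of $\min_{K\in\mathcal{K}}\mathcal{J}(K)$ of the form $K^*=R^{-1}B^\top P_{K^*}$. Suppose $K_0\in\mathcal{K}$, $\|K_0\|<\infty$, and $(A,C)$ is detectable. Let $\{K_n\}_{n\ge0}$ be generated from $K_0$, with a constant stepsize $\eta>0$, by either (a) the natural policy gradient iteration $K_{n+1}=K_n-2\eta(RK_n-B^\top P_{K_n})$ with $\eta\le\dfrac{1}{2\|R\|}$, or (b) the Gauss–Newton iteration $K_{n+1}=K_n-2\eta(K_n-R^{-1}B^\top P_{K_n})$ with $\eta\le\dfrac12$. Then the iterates converge to the global optimum $K^*$ in the sense that the average of $\{\|RK_n-B^\top P_{K_n}\|_F^2\}$ along iterations converges to zero with $O(1/N)$ rate, i.e., there is a constant $c$ such that for all $N\ge1$ $$\frac1N\sum_{n=0}^{N-1}\|RK_n-B^\top P_{K_n}\|_F^2\le\frac{c}{N}.$$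
   Context: Setting (continuous-time mixed $\mathcal{H}_2/\mathcal{H}_\infty$ design). $A\in\mathbb{R}^{m\times m}$, $B\in\mathbb{R}^{m\times d}$, $C\in\mathbb{R}^{l\times m}$, $D\in\mathbb{R}^{m\times n}$, $E\in\mathbb{R}^{l\times d}$ are real matrices satisfying $E^\top[C\ \ E]=[0\ \ R]$ for some $R>0$, and $\gamma>0$. Gains are $K\in\mathbb{R}^{d\times m}$. $\|\cdot\|$ is the operator norm, $\|\cdot\|_F$ the Frobenius norm; $X>0$ ($X\ge0$) denotes (symmetric) positive definite (semidefinite). A matrix is Hurwitz if all its eigenvalues have negative real part. Transfer function: $\mathcal{T}(K)(s)=(C^\top C+K^\top RK)^{1/2}(sI-(A-BK))^{-1}D$, with $\|\mathcal{T}(K)\|_\infty=\sup_{\omega\in\mathbb{R}}\sigma_{\max}[\mathcal{T}(K)(j\omega)]$. Feasible set: $\mathcal{K}=\{K: A-BK\text{ is Hurwitz},\ \|\mathcal{T}(K)\|_\infty<\gamma\}$. For $K\in\mathcal{K}$, $P_K\ge0$ denotes the unique stabilizing solution (it exists by the continuous-time Bounded Real Lemma) of $(A-BK)^\top P_K+P_K(A-BK)+C^\top C+K^\top RK+\gamma^{-2}P_KDD^\top P_K=0$, i.e., the unique solution with $A-BK+\gamma^{-2}DD^\top P_K$ Hurwitz. Cost: $\mathcal{J}(K)=\mathrm{tr}(P_KDD^\top)$ for $K\in\mathcal{K}$. *)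

(* Defs.v *)
From HB Require Import structures.
From mathcomp Require Export all_boot all_order all_algebra.
From mathcomp Require Export complex.
From mathcomp Require Export all_classical all_reals all_analysis.

Set Implicit Arguments.
Unset Strict Implicit.
Unset Printing Implicit Defensive.

Import Order.TTheory GRing.Theory Num.Theory.

Local Open Scope classical_set_scope.
Local Open Scope complex_scope.
Local Open Scope sesquilinear_scope.
Local Open Scope ring_scope.

Section MatrixNotions.
Context {R : realType}.

Definition symmetric_mx n (X : 'M[R]_n) : Prop := X^T = X.

Definition posdef n (X : 'M[R]_n) : Prop :=
  symmetric_mx X /\
  forall x : 'cV[R]_n, x != 0 -> 0 < (x^T *m X *m x) ord0 ord0.

Definition possemidef n (X : 'M[R]_n) : Prop :=
  symmetric_mx X /\
  forall x : 'cV[R]_n, 0 <= (x^T *m X *m x) ord0 ord0.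

Definition sqrt_mx n (X : 'M[R]_n) : 'M[R]_n :=
  xget 0 [set S | possemidef S /\ S *m S = X].

(* The norm `|M| of the library is the entrywise maximum, hence the following
   two definitions; on a column vector, frob_norm is the Euclidean norm. *)
Definition frob_norm p q (M : 'M[R]_(p, q)) : R :=
  Num.sqrt (\sum_i \sum_j M i j ^+ 2).

Definition op_norm p q (M : 'M[R]_(p, q)) : \bar R :=
  ereal_sup [set (frob_norm (M *m x))%:E
            | x in [set x : 'cV[R]_q | frob_norm x <= 1]].

Definition complex_mx p q (M : 'M[R]_(p, q)) : 'M[R[i]]_(p, q) :=
  map_mx (real_complex R) M.

Definition hurwitz n (M : 'M[R]_n) : Prop :=
  forall z : R[i], eigenvalue (complex_mx M) z -> complex.Re z < 0.

Definition detectable m l (A : 'M[R]_m) (C : 'M[R]_(l, m)) : Prop :=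
  exists L : 'M[R]_(m, l), hurwitz (A - L *m C).

Definition singular_value p q (G : 'M[R[i]]_(p, q)) (s : R) : Prop :=
  0 <= s /\ eigenvalue (G^t* *m G) (s ^+ 2)%:C.

(* For q > 0 the set is finite and nonempty; for q = 0 the value is 0. *)
Definition sigma_max p q (G : 'M[R[i]]_(p, q)) : R :=
  sup [set s | singular_value G s].

End MatrixNotions.

(* Rw is the weight written "R" in E^T [C E] = [0 R]; R is the field of reals. *)
Section MixedDesign.
Context {R : realType} {m d l n : nat}.
Variables (A : 'M[R]_m) (B : 'M[R]_(m, d)) (C : 'M[R]_(l, m)) (D : 'M[R]_(m, n)).
Variables (Rw : 'M[R]_d) (gamma : R).

Implicit Types K : 'M[R]_(d, m).

Definition state_cost K : 'M[R]_m := C^T *m C + K^T *m Rw *m K.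

(* invmx is the identity on singular matrices; when A - B K is Hurwitz,
   s I - (A - B K) is invertible for every s on the imaginary axis. *)
Definition transfer K (s : R[i]) : 'M[R[i]]_(m, n) :=
  complex_mx (sqrt_mx (state_cost K))
    *m invmx (s%:M - complex_mx (A - B *m K)) *m complex_mx D.

Definition hinf_norm K : \bar R :=
  ereal_sup [set (sigma_max (transfer K (0 +i* w)))%:E | w in [set: R]].

Definition feasible K : Prop :=
  hurwitz (A - B *m K) /\ (hinf_norm K < gamma%:E)%E.

Definition stabilizing_solution K (P : 'M[R]_m) : Prop :=
  [/\ possemidef P,
      (A - B *m K)^T *m P + P *m (A - B *m K) + state_cost K
        + gamma ^- 2 *: (P *m D *m D^T *m P) = 0
    & hurwitz (A - B *m K + gamma ^- 2 *: (D *m D^T *m P))].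

(* P_K; the default value 0 is taken only if there is no stabilizing solution,
   which does not happen for feasible K (bounded real lemma). *)
Definition riccati_sol K : 'M[R]_m :=
  xget 0 [set P | stabilizing_solution K P].

Definition cost K : R := \tr (riccati_sol K *m D *m D^T).

Definition global_optimum K : Prop :=
  feasible K /\ forall K', feasible K' -> cost K <= cost K'.

Definition residual K : 'M[R]_(d, m) := Rw *m K - B^T *m riccati_sol K.

Definition natural_gradient_step (eta : R) K : 'M[R]_(d, m) :=
  K - (2 * eta) *: (Rw *m K - B^T *m riccati_sol K).

Definition gauss_newton_step (eta : R) K : 'M[R]_(d, m) :=
  K - (2 * eta) *: (K - invmx Rw *m B^T *m riccati_sol K).

End MixedDesign.

(* Main.v *)
Require Import Defs.
From mathcomp Require Import all_boot all_order all_algebra.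
From mathcomp Require Import all_classical all_reals all_analysis.
From mathcomp Require Import complex ring lra zify.

Set Implicit Arguments.
Unset Strict Implicit.
Unset Printing Implicit Defensive.

Import Order.TTheory GRing.Theory Num.Theory.

Local Open Scope ring_scope.

(** For a gain K write A_K = A - B K, Q_K for the state cost, N = D D^T and
    Ric_K(P) = A_K^T P + P A_K + Q_K + gamma^-2 P N P, so that P_K is the
    stabilizing root of Ric_K. Let M = R K - B^T P_K be the residual.

    The whole argument rests on one computation ([riccati_op_step]): changing K
    into K' = K - Z with P = P_K kept fixed gives
    Ric_K'(P) = - Z^T M - M^T Z + Z^T R Z. For both iterations and the allowed
    stepsizes the right-hand side is at most - c M^T M with a constant c > 0
    ([natural_gradient_descent], [gauss_newton_descent]). So P_K satisfies the
    Riccati inequality for K', and strictly so in the directions in which the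
    gain has moved.

    That inequality keeps the iterates feasible. If v is an eigenvector of A_K'
    for an unstable eigenvalue, it forces C v = 0 and K' v = 0, which
    detectability excludes ([new_gain_hurwitz]). If the Hamiltonian matrix of
    the Riccati equation of K' has an imaginary eigenvalue, the inequality
    forces M x = 0 for the state part x of an eigenvector, hence K' x = K x,
    and x is then an eigenvector of the closed loop A_K + gamma^-2 N P_K, which
    is Hurwitz ([new_gain_no_imaginary]). Absence of imaginary eigenvalues gives
    the stabilizing P_K' ([stabilizing_solution_exists]), and P_K' <= P_K by a
    Lyapunov comparison ([new_gain_decrease]).

    For the rate, the trace of Ric_K'(P_K') - Ric_K'(P_K) is at least
    c |M|_F^2, and it is linear in X = P_K - P_K' >= 0, so it is at most a
    constant times tr X. The constant is uniform because the P_K decrease and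
    because a bound on P_K bounds K through the Riccati equation
    ([gain_bounded]). Since tr X telescopes, the sum of |M|_F^2 over all
    iterations is finite.

    The link with the transfer function is the bounded real lemma, proved here
    by linear algebra only. An imaginary eigenvalue of the Hamiltonian matrix
    makes gamma a singular value of the transfer function at that frequency
    ([feasible_no_imaginary]). Otherwise the characteristic polynomial splits
    into two real factors, with roots in the open left and right half planes;
    the kernels of both are isotropic for the symplectic form, hence both have
    dimension m, and the stable one is the graph of the solution
    ([stabilizing_solution_exists]). Conversely a stabilizing solution gives a
    gain bound below gamma uniform in the frequency, by completion of squares
    ([strict_gain], [hinf_norm_lt]). *)

(** * Bilinear forms and an entrywise matrix norm *)

Section Bilinear.
Context {R : realType}.

Definition bil p q (X : 'M[R]_(p, q)) (x : 'cV[R]_p) (y : 'cV[R]_q) : R :=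
  (x^T *m X *m y) ord0 ord0.

Definition sqn p (x : 'cV[R]_p) : R := bil 1%:M x x.

(** The sum of absolute values is submultiplicative and controls both quadratic
    forms ([bil_bound]) and traces ([psd_trace_mul]), which is all that the
    estimates need. *)
Definition nrm p q (M : 'M[R]_(p, q)) : R := \sum_i \sum_j `|M i j|.

Lemma mxDE p q (M N : 'M[R]_(p, q)) i j : (M + N) i j = M i j + N i j.
Proof. by rewrite mxE. Qed.

Lemma mxNE p q (M : 'M[R]_(p, q)) i j : (- M) i j = - M i j.
Proof. by rewrite mxE. Qed.

Lemma mxZE p q a (M : 'M[R]_(p, q)) i j : (a *: M) i j = a * M i j.
Proof. by rewrite mxE. Qed.

Definition mxlinE := (mxDE, mxNE, mxZE).

Lemma bilDl p q (X : 'M[R]_(p, q)) x y z : bil X (x + y) z = bil X x z + bil X y z.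
Proof. by rewrite /bil linearD /= !mulmxDl mxE. Qed.

Lemma bilDr p q (X : 'M[R]_(p, q)) x y z : bil X x (y + z) = bil X x y + bil X x z.
Proof. by rewrite /bil mulmxDr mxE. Qed.

Lemma bilZl p q (X : 'M[R]_(p, q)) a x y : bil X (a *: x) y = a * bil X x y.
Proof. by rewrite /bil linearZ /= -!scalemxAl mxE. Qed.

Lemma bilZr p q (X : 'M[R]_(p, q)) a x y : bil X x (a *: y) = a * bil X x y.
Proof. by rewrite /bil -!scalemxAr mxE. Qed.

Lemma bilNl p q (X : 'M[R]_(p, q)) x y : bil X (- x) y = - bil X x y.
Proof. by rewrite -scaleN1r bilZl mulN1r. Qed.

Lemma bilNr p q (X : 'M[R]_(p, q)) x y : bil X x (- y) = - bil X x y.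
Proof. by rewrite -scaleN1r bilZr mulN1r. Qed.

Lemma bil0l p q (X : 'M[R]_(p, q)) y : bil X 0 y = 0.
Proof. by rewrite /bil trmx0 !mul0mx mxE. Qed.

Lemma bil0r p q (X : 'M[R]_(p, q)) y : bil X y 0 = 0.
Proof. by rewrite /bil mulmx0 mxE. Qed.

Lemma bilDm p q (X Y : 'M[R]_(p, q)) x y : bil (X + Y) x y = bil X x y + bil Y x y.
Proof. by rewrite /bil mulmxDr mulmxDl mxE. Qed.

Lemma bilZm p q a (X : 'M[R]_(p, q)) x y : bil (a *: X) x y = a * bil X x y.
Proof. by rewrite /bil -scalemxAr -scalemxAl mxE. Qed.

Lemma bilNm p q (X : 'M[R]_(p, q)) x y : bil (- X) x y = - bil X x y.
Proof. by rewrite -scaleN1r bilZm mulN1r. Qed.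

Lemma bil0m p q x y : bil (0 : 'M[R]_(p, q)) x y = 0.
Proof. by rewrite /bil mulmx0 mul0mx mxE. Qed.

Definition bilE := (bilDl, bilDr, bilZl, bilZr, bilNl, bilNr, bilDm, bilZm, bilNm).

Lemma bil_tr p q (X : 'M[R]_(p, q)) x y : bil X^T x y = bil X y x.
Proof.
have -> : bil X^T x y = (y^T *m X *m x)^T ord0 ord0.
  by rewrite !trmx_mul trmxK mulmxA.
by rewrite mxE.
Qed.

Lemma bil_sym p (X : 'M[R]_p) x y : X^T = X -> bil X x y = bil X y x.
Proof. by move=> sX; rewrite -{1}sX bil_tr. Qed.

Lemma bil_mulr p q r (X : 'M[R]_(p, q)) (Y : 'M[R]_(q, r)) x y :
  bil (X *m Y) x y = bil X x (Y *m y).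
Proof. by rewrite /bil !mulmxA. Qed.

Lemma bil_mull p q r (X : 'M[R]_(p, q)) (Y : 'M[R]_(q, r)) x y :
  bil (X *m Y) x y = bil Y (X^T *m x) y.
Proof. by rewrite /bil trmx_mul trmxK !mulmxA. Qed.

Lemma sqnE p (x : 'cV[R]_p) : sqn x = \sum_i x i ord0 ^+ 2.
Proof.
rewrite /sqn /bil mulmx1 mxE; apply: eq_bigr => i _.
by rewrite mxE expr2.
Qed.

Lemma sqn_ge0 p (x : 'cV[R]_p) : 0 <= sqn x.
Proof. by rewrite sqnE sumr_ge0 // => i _; rewrite sqr_ge0. Qed.

Lemma sqn_entry p (x : 'cV[R]_p) i : x i ord0 ^+ 2 <= sqn x.
Proof.
rewrite sqnE (bigD1 i) //= lerDl sumr_ge0 // => j _; exact: sqr_ge0.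
Qed.

Lemma sqn_eq0 p (x : 'cV[R]_p) : sqn x <= 0 -> x = 0.
Proof.
move=> h; apply/matrixP => i j; rewrite ord1 mxE; apply/eqP.
rewrite -sqrf_eq0 eq_le sqr_ge0 andbT; exact: le_trans (sqn_entry x i) h.
Qed.

Lemma sqn0 p : sqn (0 : 'cV[R]_p) = 0.
Proof. by rewrite /sqn bil0l. Qed.

Lemma bil1E p (x y : 'cV[R]_p) : bil 1%:M x y = (x^T *m y) ord0 ord0.
Proof. by rewrite /bil mulmx1. Qed.

Lemma sqn_mul p q (M : 'M[R]_(p, q)) x : sqn (M *m x) = bil (M^T *m M) x x.
Proof. by rewrite /sqn bil1E /bil trmx_mul !mulmxA. Qed.

Lemma bilC1 p (x y : 'cV[R]_p) : bil 1%:M x y = bil 1%:M y x.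
Proof. by apply: bil_sym; rewrite trmx1. Qed.

Lemma nrm_ge0 p q (M : 'M[R]_(p, q)) : 0 <= nrm M.
Proof. by apply: sumr_ge0 => i _; apply: sumr_ge0. Qed.

Lemma nrmD p q (M N : 'M[R]_(p, q)) : nrm (M + N) <= nrm M + nrm N.
Proof.
rewrite /nrm -big_split /=; apply: ler_sum => i _.
by rewrite -big_split /=; apply: ler_sum => j _; rewrite mxE ler_normD.
Qed.

Lemma nrmZ p q a (M : 'M[R]_(p, q)) : nrm (a *: M) = `|a| * nrm M.
Proof.
rewrite /nrm mulr_sumr; apply: eq_bigr => i _; rewrite mulr_sumr.
by apply: eq_bigr => j _; rewrite mxE normrM.
Qed.

Lemma nrmN p q (M : 'M[R]_(p, q)) : nrm (- M) = nrm M.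
Proof. by rewrite -scaleN1r nrmZ normrN1 mul1r. Qed.

Lemma nrm_tr p q (M : 'M[R]_(p, q)) : nrm M^T = nrm M.
Proof.
rewrite /nrm exchange_big; apply: eq_bigr => i _.
by apply: eq_bigr => j _; rewrite mxE.
Qed.

Lemma nrmM p q r (M : 'M[R]_(p, q)) (N : 'M[R]_(q, r)) :
  nrm (M *m N) <= nrm M * nrm N.
Proof.
rewrite {2}/nrm mulr_suml; apply: ler_sum => i _.
apply: (@le_trans _ _ (\sum_j \sum_k `|M i k| * `|N k j|)).
  apply: ler_sum => j _; rewrite mxE; apply: le_trans (ler_norm_sum _ _ _) _.
  by apply: ler_sum => k _; rewrite normrM.
rewrite exchange_big mulr_suml /=; apply: ler_sum => k _.
rewrite -mulr_sumr ler_wpM2l // /nrm (bigD1 k) //= lerDl.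
by apply: sumr_ge0 => a _; apply: sumr_ge0.
Qed.

Lemma bil_bound p (X : 'M[R]_p) x : `|bil X x x| <= nrm X * sqn x.
Proof.
have -> : bil X x x = \sum_i \sum_j X i j * (x i ord0 * x j ord0).
  rewrite /bil -mulmxA mxE; apply: eq_bigr => i _.
  rewrite !mxE mulr_sumr; apply: eq_bigr => j _; ring.
rewrite /nrm mulr_suml; apply: le_trans (ler_norm_sum _ _ _) _.
apply: ler_sum => i _; rewrite mulr_suml; apply: le_trans (ler_norm_sum _ _ _) _.
apply: ler_sum => j _; rewrite normrM ler_wpM2l //.
have := sqn_entry x i; have := sqn_entry x j.
by rewrite ler_norml => *; apply/andP; split; nra.
Qed.

End Bilinear.

(** * Eigenvectors of real matrices as pairs of real vectors *)

Section RealPairs.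
Context {R : realType}.

Lemma eigenvalue_trmx (F : fieldType) n (g : 'M[F]_n) a :
  eigenvalue g^T a = eigenvalue g a.
Proof.
rewrite !eigenvalue_root_char; congr (root _ _).
rewrite /char_poly -det_tr; congr (\det _).
by rewrite /char_poly_mx linearB /= tr_scalar_mx map_trmx trmxK.
Qed.

(** The complex matrix a + i b. *)
Definition cpair p q (a b : 'M[R]_(p, q)) : 'M[R[i]]_(p, q) :=
  \matrix_(i, j) Complex (a i j) (b i j).

Lemma cpair_inj p q (a b a' b' : 'M[R]_(p, q)) :
  cpair a b = cpair a' b' -> a = a' /\ b = b'.
Proof.
move=> /matrixP h; split; apply/matrixP => i j.
  by move: (h i j); rewrite !mxE => -[].
by move: (h i j); rewrite !mxE => -[].
Qed.

Lemma cpairP p q (V : 'M[R[i]]_(p, q)) : exists a b, V = cpair a b.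
Proof.
exists (map_mx (@complex.Re R) V), (map_mx (@complex.Im R) V).
by apply/matrixP => i j; rewrite !mxE; case: (V i j).
Qed.

Lemma cpair00 p q : cpair (0 : 'M[R]_(p, q)) 0 = 0.
Proof. by apply/matrixP => i j; rewrite !mxE. Qed.

Lemma cpair_eq0 p q (a b : 'M[R]_(p, q)) : cpair a b = 0 -> a = 0 /\ b = 0.
Proof. by rewrite -cpair00 => /cpair_inj. Qed.

Lemma complex_sum (I : finType) (f g : I -> R) :
  \sum_i (Complex (f i) (g i)) = Complex (\sum_i f i) (\sum_i g i).
Proof.
apply: (big_ind3 (fun (x : R[i]) y z => x = Complex y z)) => //.
by move=> x1 x2 x3 y1 y2 y3 -> ->.
Qed.

Lemma complex_mulmx p q r (M : 'M[R]_(p, q)) (a b : 'M[R]_(q, r)) :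
  complex_mx M *m cpair a b = cpair (M *m a) (M *m b).
Proof.
apply/matrixP => i j; rewrite !mxE.
rewrite -complex_sum; apply: eq_bigr => k _; rewrite !mxE.
by apply/eqP; rewrite eq_complex /= !mul0r subr0 addr0 !eqxx.
Qed.

Lemma cpairZ p q (al be : R) (a b : 'M[R]_(p, q)) :
  Complex al be *: cpair a b = cpair (al *: a - be *: b) (be *: a + al *: b).
Proof.
apply/matrixP => i j; rewrite !mxE; apply/eqP; rewrite eq_complex /=.
by rewrite eqxx addrC eqxx.
Qed.

Lemma cpairB p q (a b a' b' : 'M[R]_(p, q)) :
  cpair a b - cpair a' b' = cpair (a - a') (b - b').
Proof. by apply/matrixP => i j; rewrite !mxE. Qed.

(** The real and imaginary parts of G v = (al + i be) v for v = a + i b. *)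
Definition real_eigenpair n (G : 'M[R]_n) (al be : R) (a b : 'cV[R]_n) : Prop :=
  G *m a = al *: a - be *: b /\ G *m b = be *: a + al *: b.

Lemma eigen_colP (F : fieldType) n (g : 'M[F]_n) z :
  eigenvalue g z <-> exists2 v : 'cV[F]_n, v != 0 & g *m v = z *: v.
Proof.
rewrite -eigenvalue_trmx; split.
  move=> /eigenvalueP [v hv nz]; exists v^T; first by rewrite trmx_eq0.
  by rewrite -[g]trmxK -trmx_mul hv linearZ.
move=> [v nz hv]; apply/eigenvalueP; exists v^T; last by rewrite trmx_eq0.
by rewrite -trmx_mul hv linearZ.
Qed.

Lemma eigenvalue_pairP n (G : 'M[R]_n) al be :
  eigenvalue (complex_mx G) (Complex al be) <->
  exists a b, real_eigenpair G al be a b /\ (a != 0 \/ b != 0).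
Proof.
rewrite eigen_colP; split.
  move=> [v]; have [a [b ->]] := cpairP v => nz.
  rewrite complex_mulmx cpairZ => /cpair_inj [h1 h2].
  exists a, b; split=> //; have [a0|] := eqVneq a 0; last by left.
  by right; apply: contraNneq nz => b0; rewrite a0 b0 cpair00.
move=> [a [b [[h1 h2] nz]]]; exists (cpair a b).
  by apply/negP => /eqP /cpair_eq0 [a0 b0]; move: nz; rewrite a0 b0 eqxx; case.
by rewrite complex_mulmx cpairZ h1 h2.
Qed.

Lemma hurwitzP n (G : 'M[R]_n) :
  hurwitz G <-> forall al be a b, 0 <= al -> real_eigenpair G al be a b ->
    a = 0 /\ b = 0.
Proof.
split=> [h al be a b al0 hp|h [al be]].
  have [->|na] := eqVneq a 0; have [->|nb] := eqVneq b 0 => //.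
  - have /h /= : eigenvalue (complex_mx G) (Complex al be).
      by apply/eigenvalue_pairP; exists a, b; split=> //; right.
    by rewrite ltNge al0.
  - have /h /= : eigenvalue (complex_mx G) (Complex al be).
      by apply/eigenvalue_pairP; exists a, b; split=> //; left.
    by rewrite ltNge al0.
  - have /h /= : eigenvalue (complex_mx G) (Complex al be).
      by apply/eigenvalue_pairP; exists a, b; split=> //; left.
    by rewrite ltNge al0.
move=> /eigenvalue_pairP [a [b [hp nz]]] /=; rewrite ltNge; apply/negP => al0.
by have [a0 b0] := h _ _ _ _ al0 hp; move: nz; rewrite a0 b0 eqxx; case.
Qed.

Lemma hurwitz_trmx n (G : 'M[R]_n) : hurwitz G -> hurwitz G^T.
Proof.
move=> h z; rewrite /complex_mx -map_trmx eigenvalue_trmx; exact: h.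
Qed.

Lemma hurwitz0 (G : 'M[R]_0) : hurwitz G.
Proof. by apply/hurwitzP => al be a b _ _; rewrite !flatmx0. Qed.

End RealPairs.

(** * Lyapunov inequalities *)

Section Certificate.
Context {R : realType}.

(** The product of the factors G - z, for z in rs, acting on real vectors: J
    stands for multiplication by i, so G - z becomes G - Re z - (Im z) J. *)
Fixpoint shift_prod N (G J : 'M[R]_N) (rs : seq R[i]) (x : 'cV[R]_N) : 'cV[R]_N :=
  if rs is z :: rs' then
    shift_prod G J rs' (G *m x - complex.Re z *: x - complex.Im z *: (J *m x))
  else x.

(** Induction on the list of roots. For z = al + i be with al < 0 and
    y = (G - z) x, skew-symmetry of J gives x^T G x = al |x|^2 + x^T y. If V is
    the form obtained for the other roots, the form |x|^2 / m + V(y) / m^2 with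
    m = - al works: the cross term x^T y is absorbed half by - al |x|^2 and half
    by the decay |y|^2 of V along G, which commutes with G - z. *)
Lemma shift_prod_certificate N (G J : 'M[R]_N) (rs : seq R[i]) :
  J^T = - J -> G *m J = J *m G -> all (fun z => complex.Re z < 0) rs ->
  exists Y : 'M[R]_N, exists c : R,
    [/\ possemidef Y, 0 <= c &
      forall x, sqn x - c * sqn (shift_prod G J rs x) <= - (2 * bil Y x (G *m x))].
Proof.
move=> aJ cJ; elim: rs => [_|z rs IH /= /andP[hz hrs]].
  exists 0, 1; split=> //.
    by split; [rewrite /symmetric_mx trmx0|move=> x; have := bil0m x x; rewrite /bil => ->].
  by move=> x; rewrite /= bil0m mul1r subrr mulr0 oppr0.
have [Y [c [[sY pY] c0 hY]]] := IH hrs.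
set al := complex.Re z in hz *; set be := complex.Im z.
pose F := G - al%:M - be *: J.
have FE x : G *m x - al *: x - be *: (J *m x) = F *m x.
  by rewrite /F !mulmxBl mul_scalar_mx scalemxAl.
have FG : F *m G = G *m F.
  rewrite /F !mulmxBl !mulmxBr scalar_mxC -scalemxAl -scalemxAr cJ //.
pose m := - al; have m0 : 0 < m by rewrite /m; lra.
pose W := m^-1 *: 1%:M + (m^-1 ^+ 2) *: (F^T *m Y *m F).
have WE x y : bil W x y = m^-1 * bil 1%:M x y + m^-1 ^+ 2 * bil Y (F *m x) (F *m y).
  by rewrite /W bilDm !bilZm -mulmxA bil_mull trmxK bil_mulr.
have mi0 : 0 < m^-1 by rewrite invr_gt0.
exists W, (m^-1 ^+ 2 * c); split.
- split; first by rewrite /symmetric_mx /W linearD !linearZ /= trmx1 !trmx_mul trmxK sY mulmxA.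
  move=> x; have := WE x x; rewrite {1}/bil => ->.
  apply: addr_ge0; apply: mulr_ge0; rewrite ?exprn_ge0 ?(ltW mi0) //.
    exact: sqn_ge0.
  exact: pY.
- by rewrite mulr_ge0 // exprn_ge0 // ltW.
move=> x; rewrite FE WE mulmxA FG -mulmxA.
have := hY (F *m x).
set y := F *m x.
have Gx : G *m x = y + al *: x + be *: (J *m x).
  by rewrite /y -FE addrAC subrK subrK.
have Jx : bil 1%:M x (J *m x) = 0.
  have : bil J^T x x = - bil J x x by rewrite aJ bilNm.
  by rewrite bil_tr -bil_mulr mul1mx; lra.
have -> : bil 1%:M x (G *m x) = bil 1%:M x y - m * sqn x.
  by rewrite Gx !bilE Jx /sqn /m; ring.
have : 0 <= m ^+ 2 * sqn x - 2 * m * bil 1%:M x y + sqn y.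
  have := sqn_ge0 (m *: x - y); rewrite /sqn !bilE (bilC1 y x); lra.
set s := sqn x; set t := sqn y; set u := bil _ x y; set v := bil Y _ _; set w := sqn _.
move=> h1 h2.
have e : m * m^-1 = 1 by rewrite divff // gt_eqF.
have h3 : m^-1 ^+ 2 * (t - c * w) <= m^-1 ^+ 2 * - (2 * v).
  by rewrite ler_wpM2l // exprn_ge0 // ltW.
have h4 : 0 <= m^-1 ^+ 2 * (m ^+ 2 * s - 2 * m * u + t).
  by rewrite mulr_ge0 ?exprn_ge0 ?(ltW mi0).
have : m^-1 ^+ 2 * (m ^+ 2 * s - 2 * m * u + t) =
  (m * m^-1)^+2 * s - 2 * (m * m^-1) * m^-1 * u + m^-1 ^+ 2 * t by ring.
rewrite e => e2; rewrite e2 in h4.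
have -> : - (2 * (m^-1 * (u - m * s) + m^-1 ^+ 2 * v)) =
  - 2 * m^-1 * u + 2 * (m * m^-1) * s - 2 * m^-1 ^+2 * v by ring.
rewrite e; move: h3 h4; lra.
Qed.

End Certificate.

Section Lyapunov.
Context {R : realType}.

Lemma shift_prod_horner n (G : 'M[R]_n.+1) (rs : seq R[i]) (a b : 'cV[R]_n.+1) :
  let s := shift_prod (block_mx G 0 0 G) (block_mx 0 (- 1%:M) 1%:M 0) rs (col_mx a b) in
  horner_mx (complex_mx G) (\prod_(z <- rs) ('X - z%:P)) *m cpair a b =
  cpair (usubmx s) (dsubmx s).
Proof.
elim: rs a b => [|z rs IH] a b /=.
  by rewrite big_nil rmorph1 mul1mx col_mxKu col_mxKd.
rewrite big_cons mulrC rmorphM /= rmorphB /= horner_mx_X horner_mx_C.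
rewrite -mulmxE -mulmxA mulmxBl complex_mulmx mul_scalar_mx.
case: z => al be /=; rewrite cpairZ cpairB IH.
set s1 := shift_prod _ _ _ _; set s2 := shift_prod _ _ _ _.
suff -> : s1 = s2 by [].
rewrite /s1 /s2; congr (shift_prod _ _ _ _).
rewrite !mul_block_col !mul0mx !mulNmx !mul1mx !addr0 !add0r.
rewrite !scale_col_mx !opp_col_mx !add_col_mx; congr col_mx.
  by rewrite scalerN opprK opprB addrA addrAC.
by rewrite opprD addrA addrAC.
Qed.

Lemma complex_roots n (G : 'M[R]_n) : exists rs : seq R[i],
  char_poly (complex_mx G) = \prod_(z <- rs) ('X - z%:P).
Proof.
have [rs e] := closed_field_poly_normal (char_poly (complex_mx G)).
exists rs; rewrite e; have /monicP -> := char_poly_monic (complex_mx G).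
by rewrite scale1r.
Qed.

(** By Cayley-Hamilton the remainder of [shift_prod_certificate] vanishes when the
    list consists of the roots of the characteristic polynomial. The complex
    space is realized as pairs of real vectors, and the certificate is then
    restricted to real vectors. *)
Lemma hurwitz_certificate n (G : 'M[R]_n) : hurwitz G ->
  exists2 Y : 'M[R]_n, possemidef Y & forall x, sqn x <= - (2 * bil Y x (G *m x)).
Proof.
case: n G => [|n] G hG.
  exists 0; first by split=> [|x]; rewrite ?/symmetric_mx ?trmx0 // mulmx0 mul0mx mxE.
  by move=> x; rewrite bil0m (flatmx0 x) sqn0 mulr0 oppr0.
have [rs ers] := complex_roots G.
have hrs : all (fun z => complex.Re z < 0) rs.
  apply/allP => z zrs; apply: hG; rewrite eigenvalue_root_char ers.
  by rewrite root_prod_XsubC.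
pose G2 := block_mx G 0 0 G : 'M[R]_(n.+1 + n.+1).
pose J := block_mx 0 (- 1%:M) 1%:M 0 : 'M[R]_(n.+1 + n.+1).
have aJ : J^T = - J.
  by rewrite /J tr_block_mx opp_block_mx !trmx0 !oppr0 linearN /= trmx1 opprK.
have cJ : G2 *m J = J *m G2.
  by rewrite /G2 /J !mulmx_block !(mul0mx, mulmx0, add0r, addr0, mul1mx, mulmx1, mulmxN, mulNmx).
have [Y [c [[sY pY] c0 hY]]] := shift_prod_certificate aJ cJ hrs.
have bilY x y : bil (ulsubmx Y) x y = bil Y (col_mx x 0) (col_mx y 0).
  rewrite /bil -[in RHS](submxK Y) tr_col_mx trmx0 mul_row_block !mul0mx !addr0.
  by rewrite mul_row_col mulmx0 addr0.
exists (ulsubmx Y).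
  split; first by rewrite /symmetric_mx trmx_ulsub sY.
  by move=> x; have := bilY x x; rewrite {1}/bil => ->; exact: pY.
move=> x; rewrite bilY; have := hY (col_mx x 0).
have -> : shift_prod G2 J rs (col_mx x 0) = 0.
  have := shift_prod_horner G rs x 0; rewrite -ers Cayley_Hamilton mul0mx.
  by move/esym/cpair_eq0 => [h1 h2]; rewrite -[LHS]vsubmxK h1 h2 col_mx0.
rewrite sqn0 mulr0 subr0 /G2 mul_block_col !mul0mx !mulmx0 !addr0.
suff -> : sqn (col_mx x 0 : 'cV[R]_(n.+1 + n.+1)) = sqn x by [].
by rewrite /sqn !bil1E tr_col_mx mul_row_col trmx0 mulmx0 addr0.
Qed.

(** The form X is nonnegative at (1 + t G) x; expanding for a small t > 0 turns
    decay of X along G into a positive lower bound of X itself. *)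
Lemma psd_definite n (X G : 'M[R]_n) (k : R) : possemidef X -> 0 < k ->
  (forall x, k * sqn x <= - (2 * bil X x (G *m x))) ->
  exists2 c : R, 0 < c & forall x, c * sqn x <= bil X x x.
Proof.
move=> [sX pX] k0 h.
pose C := nrm (G^T *m X *m G).
have C0 : 0 <= C := nrm_ge0 _.
pose t := k / (C + 1).
have C1 : 0 < C + 1 by lra.
have t0 : 0 < t by rewrite divr_gt0.
exists (t ^+ 2) => [|x]; first by rewrite exprn_gt0.
have : 0 <= bil X (x + t *: (G *m x)) (x + t *: (G *m x)) by exact: pX.
rewrite !bilE (bil_sym (G *m x) x sX).
have : `|bil X (G *m x) (G *m x)| <= C * sqn x.
  by have := bil_bound (G^T *m X *m G) x; rewrite bil_mulr bil_mull trmxK.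
rewrite ler_norml => /andP[_ h1].
have h2 : t * (k * sqn x) <= t * - (2 * bil X x (G *m x)) by rewrite ler_wpM2l ?(ltW t0).
have h3 : t ^+ 2 * bil X (G *m x) (G *m x) <= t ^+ 2 * (C * sqn x).
  by rewrite ler_wpM2l // exprn_ge0 // ltW.
have e : t * k = t ^+ 2 * (C + 1).
  by rewrite expr2 -mulrA; congr (_ * _); rewrite /t divfK // gt_eqF.
have : t * (k * sqn x) = t ^+ 2 * (C + 1) * sqn x by rewrite mulrA e.
move: h2 h3; lra.
Qed.

(** With Y the certificate of [hurwitz_certificate], consider the smallest t >= 0
    such that X + t Y is nonnegative. If t > 0, then X + t Y decays strictly along
    G, so it is bounded below by a positive multiple of the identity
    ([psd_definite]), and t could be decreased. *)
Lemma lyapunov_ge0 n (G X : 'M[R]_n) : hurwitz G -> X^T = X ->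
  (forall x, bil X x (G *m x) <= 0) -> possemidef X.
Proof.
move=> hG sX hX; have [Y [sY pY] hY] := hurwitz_certificate hG.
have sXY t : (X + t *: Y)^T = X + t *: Y by rewrite linearD linearZ /= sX sY.
have [c c0 hc] : exists2 c : R, 0 < c & forall x, c * sqn x <= bil Y x x.
  by apply: (@psd_definite _ Y G 1) => // x; rewrite mul1r.
pose T := [set t : R | 0 <= t /\ forall x, 0 <= bil (X + t *: Y) x x]%classic.
have hT x : bil X x x <= nrm X * sqn x /\ - (nrm X * sqn x) <= bil X x x.
  by have := bil_bound X x; rewrite ler_norml => /andP[].
(* Y is bounded below by c and X by - nrm X *)
have Tne : T (nrm X / c).
  split=> [|x]; first by rewrite divr_ge0 ?nrm_ge0 // ltW.
  rewrite !bilE; have [_ h] := hT x.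
  have : nrm X / c * (c * sqn x) <= nrm X / c * bil Y x x.
    by rewrite ler_wpM2l // divr_ge0 ?nrm_ge0 // ltW.
  rewrite mulrA divfK ?gt_eqF //; lra.
have Tinf : has_inf T by split; [exists (nrm X / c)|exists 0 => t []].
set t0 := inf T.
have t00 : 0 <= t0 by apply: lb_le_inf; [exists (nrm X / c)|move=> t []].
have p0 x : 0 <= bil (X + t0 *: Y) x x.
  rewrite leNgt; apply/negP => neg.
  have s0 : 0 < sqn x.
    rewrite lt_neqAle sqn_ge0 andbT eq_sym; apply/eqP => /eqP.
    by rewrite eq_le => /andP[/sqn_eq0 x0 _]; move: neg; rewrite x0 bil0l ltxx.
  have y0 : 0 < bil Y x x by apply: lt_le_trans (hc x); rewrite mulr_gt0.
  pose e := - bil (X + t0 *: Y) x x / bil Y x x.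
  have e0 : 0 < e by rewrite divr_gt0 // oppr_gt0.
  (* some admissible t lies so close to t0 that X + t Y is still negative at x *)
  have [t [tge tp] tlt] := inf_adherent e0 Tinf.
  have := tp x; rewrite bilDm bilZm.
  have : t * bil Y x x < (t0 + e) * bil Y x x by rewrite ltr_pM2r.
  rewrite mulrDl /e divfK ?gt_eqF // bilDm bilZm; lra.
have [t0z|t0p] := eqVneq t0 0.
  by split=> // x; have := p0 x; rewrite t0z scale0r addr0.
have tpos : 0 < t0 by rewrite lt_neqAle eq_sym t0p.
have [d d0 hd] : exists2 d : R, 0 < d & forall x, d * sqn x <= bil (X + t0 *: Y) x x.
  apply: (@psd_definite _ _ G t0) => // [|x]; first by split=> //; exact: p0.
  rewrite bilDm bilZm.
  have : t0 * sqn x <= t0 * - (2 * bil Y x (G *m x)) by rewrite ler_wpM2l.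
  have := hX x; lra.
(* small enough for e Y <= d, and not larger than t0 *)
pose e := Num.min t0 (d / (nrm Y + 1)).
have nY := nrm_ge0 Y; have nY1 : 0 < nrm Y + 1 by lra.
have e0 : 0 < e by rewrite lt_min tpos divr_gt0.
have : T (t0 - e).
  split=> [|x]; first by rewrite subr_ge0 ge_min lexx.
  have -> : bil (X + (t0 - e) *: Y) x x = bil (X + t0 *: Y) x x - e * bil Y x x.
    by rewrite !(bilDm, bilZm); ring.
  have hdx := hd x; have := bil_bound Y x; rewrite ler_norml => /andP[_ h].
  have h1 : e * bil Y x x <= e * (nrm Y * sqn x) by rewrite ler_wpM2l // ltW.
  have sx := sqn_ge0 x.
  have h2 : e * (nrm Y + 1) <= d by rewrite -ler_pdivlMr // ge_min lexx orbT.
  have h3 : e * (nrm Y + 1) * sqn x <= d * sqn x by rewrite ler_wpM2r.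
  have : 0 <= e * sqn x by rewrite mulr_ge0 // ltW.
  move: h1 h3 hdx; lra.
move=> /(ge_inf Tinf.2); rewrite -/t0; lra.
Qed.

End Lyapunov.

(** * Real factors of a polynomial without imaginary roots *)

Section Split.
Context {R : realType}.
Local Notation toC := (map_poly (real_complex R)).

Lemma real_poly_conj (p : {poly R[i]}) : map_poly (@conjc R) p = p ->
  toC (map_poly (@complex.Re R) p) = p.
Proof.
move=> /polyP h; apply/polyP => k; have := h k.
rewrite !coef_map /=; case: (p`_k) => a b /= [e]; congr Complex; lra.
Qed.

(** The roots of a real polynomial are stable under conjugation, and so are those
    with negative real part; the corresponding factors therefore have real
    coefficients. *)
Lemma real_poly_split (p : {poly R}) : p \is monic ->
  (forall z, root (toC p) z -> complex.Re z != 0) ->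
  exists p1 p2 : {poly R}, [/\ p = p1 * p2,
    forall z, root (toC p1) z -> complex.Re z < 0 &
    forall z, root (toC p2) z -> 0 < complex.Re z].
Proof.
move=> mp hp.
have [rs ers] : exists rs : seq R[i], toC p = \prod_(z <- rs) ('X - z%:P).
  have [rs e] := closed_field_poly_normal (toC p); exists rs; rewrite e.
  by have /monicP -> : toC p \is monic := monic_map _ mp; rewrite scale1r.
have conj_prod s : map_poly (@conjc R) (\prod_(z <- s) ('X - z%:P)) =
    \prod_(z <- map (@conjc R) s) ('X - z%:P).
  rewrite rmorph_prod big_map; apply: eq_bigr => z _.
  by rewrite rmorphB /= map_polyX map_polyC.
have prs : perm_eq (map (@conjc R) rs) rs.
  rewrite prod_XsubC_eq // -conj_prod -ers; apply/polyP => k.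
  by rewrite !coef_map /= oppr0.
have filt (P : pred R[i]) : (forall z, P (conjc z) = P z) ->
    exists2 q, toC q = \prod_(z <- seq.filter P rs) ('X - z%:P) &
      forall z, root (toC q) z -> P z && (z \in rs).
  move=> hP; exists (map_poly (@complex.Re R) (\prod_(z <- seq.filter P rs) ('X - z%:P))).
    apply: real_poly_conj; rewrite conj_prod; apply: perm_big.
    have -> : map (@conjc R) (seq.filter P rs) = seq.filter P (map (@conjc R) rs).
      by rewrite filter_map; congr map; apply: eq_filter => z /=; rewrite hP.
    exact: perm_filter.
  move=> z; rewrite real_poly_conj; first by rewrite root_prod_XsubC mem_filter.
  rewrite conj_prod; apply: perm_big.
  have -> : map (@conjc R) (seq.filter P rs) = seq.filter P (map (@conjc R) rs).
    by rewrite filter_map; congr map; apply: eq_filter => w /=; rewrite hP.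
  exact: perm_filter.
have reJ (z : R[i]) : complex.Re (conjc z) = complex.Re z by case: z.
have [|p1 e1 r1] := filt (fun z => complex.Re z < 0); first by move=> z; rewrite reJ.
have [|p2 e2 r2] := filt (fun z => ~~ (complex.Re z < 0)); first by move=> z; rewrite reJ.
exists p1, p2; split.
- apply: (@map_poly_inj _ _ (real_complex R)); rewrite rmorphM /= ers e1 e2.
  by rewrite -big_cat; apply: perm_big; rewrite perm_sym perm_filterC.
- by move=> z /r1 /andP[].
- move=> z /r2 /andP[h]; rewrite -root_prod_XsubC -ers => /hp nz.
  by rewrite lt_neqAle eq_sym nz leNgt.
Qed.

Lemma coprimep_disjoint_roots (p q : {poly R}) :
  (forall z, root (toC p) z -> ~~ root (toC q) z) -> coprimep p q.
Proof.
move=> h; rewrite -(coprimep_map (real_complex R)).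
by apply: Pdiv.ClosedField.root_coprimep => x /h.
Qed.

Lemma root_comp_opp (p : {poly R}) z :
  root (toC (p \Po (- 'X))) z = root (toC p) (- z).
Proof. by rewrite map_comp_poly rmorphN /= map_polyX /root horner_comp !hornerE. Qed.

End Split.

(** * Stabilizing Riccati solutions from invariant subspaces *)

Section Hamiltonian.
Context {R : realType}.
Local Notation toC := (map_poly (real_complex R)).

(** In the application N is gamma^-2 D D^T. *)
Definition hamiltonian n (A N Q : 'M[R]_n) : 'M[R]_(n + n) :=
  block_mx A N (- Q) (- A^T).

Definition symplectic n : 'M[R]_(n + n) := block_mx 0 1%:M (- 1%:M) 0.

Lemma horner_mx_intertwine (F0 : fieldType) m n (F : 'M[F0]_m.+1) (G : 'M[F0]_n.+1)
    (V : 'M[F0]_(m.+1, n.+1)) (p : {poly F0}) :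
  V *m G = F *m V -> V *m horner_mx G p = horner_mx F p *m V.
Proof.
move=> h; elim/poly_ind: p => [|p c IH]; first by rewrite !rmorph0 mul0mx mulmx0.
rewrite !rmorphD !rmorphM /= !horner_mx_X !horner_mx_C mulmxDr mulmxDl.
by rewrite -!mulmxE mulmxA IH -!mulmxA h mul_mx_scalar mul_scalar_mx.
Qed.

Lemma horner_mx_comp_opp n (F : 'M[R]_n.+1) p :
  horner_mx F (p \Po (- 'X)) = horner_mx (- F) p.
Proof.
elim/poly_ind: p => [|p c IH]; first by rewrite comp_poly0 !rmorph0.
rewrite comp_polyD comp_polyM comp_polyX comp_polyC !rmorphD !rmorphM /=.
by rewrite rmorphN /= !horner_mx_X !horner_mx_C IH.
Qed.

Lemma horner_mx_tr n (F : 'M[R]_n.+1) p : horner_mx F^T p = (horner_mx F p)^T.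
Proof.
elim/poly_ind: p => [|p c IH]; first by rewrite !rmorph0 trmx0.
rewrite !rmorphD !rmorphM /= !horner_mx_X !horner_mx_C linearD /= tr_scalar_mx.
rewrite -!mulmxE trmx_mul -IH; congr (_ + _).
by have := comm_horner_mx2 F^T p 'X; rewrite horner_mx_X.
Qed.

(** Since M J = - J M^T, moving p(M) across J turns it into p(-M)^T. A Bezout
    relation between p and p(-X) writes every vector of ker p(M) as the image of
    another vector of that kernel under p(-M), so the form vanishes on it. *)
Lemma isotropic_kermxpoly m n (V : 'M[R]_(m, n.+1)) (M J : 'M[R]_n.+1) p :
  M *m J = - (J *m M^T) -> coprimep p (p \Po (- 'X)) ->
  V *m horner_mx M p = 0 -> V *m J *m V^T = 0.
Proof.
move=> hJ /Bezout_eq1_coprimepP [[/= u v] uv] hV.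
(* the rows of V are images under p(-M) *)
have e1 : V = V *m horner_mx M v *m horner_mx M (p \Po (- 'X)).
  rewrite -mulmxA mulmxE -rmorphM /=.
  have /(congr1 (fun f => V *m horner_mx M f)) := uv.
  rewrite rmorphD rmorphM /= rmorph1 mulmx1 mulmxDr => {1}<-.
  have -> : horner_mx M u * horner_mx M p = horner_mx M p * horner_mx M u.
    exact: comm_horner_mx2.
  by rewrite -mulmxE mulmxA hV mul0mx add0r.
have e2 : horner_mx M p *m J = J *m horner_mx (- M^T) p.
  have := @horner_mx_intertwine R n n M (- M^T) J p; rewrite mulmxN -hJ => -> //.
rewrite {2}e1 horner_mx_comp_opp !trmx_mul -horner_mx_tr linearN /=.
by rewrite !mulmxA -(mulmxA V) -e2 mulmxA hV !mul0mx.
Qed.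

End Hamiltonian.

Section Graph.
Context {R : realType}.
Local Notation toC := (map_poly (real_complex R)).

Lemma hurwitz_annihilated n (G : 'M[R]_n.+1) p : horner_mx G p = 0 ->
  (forall z, root (toC p) z -> complex.Re z < 0) -> hurwitz G.
Proof.
move=> hp hr z; rewrite eigenvalue_root_min => rz; apply: hr.
have : mxminpoly (complex_mx G) %| toC p.
  apply: mxminpoly_min; rewrite -map_horner_mx hp; exact: map_mx0.
by move=> /dvdpP [q ->]; rewrite rootM rz orbT.
Qed.

Lemma hurwitz_root n (G : 'M[R]_n) z : hurwitz G ->
  root (toC (char_poly G)) z -> complex.Re z < 0.
Proof. by move=> hG rz; apply: hG; rewrite eigenvalue_root_char -map_char_poly. Qed.

Lemma isotropic_rank n m (V : 'M[R]_(m, n + n)) :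
  V *m symplectic n *m V^T = 0 -> (\rank V <= n)%N.
Proof.
move=> h; have uJ : (symplectic n : 'M[R]_(n + n)) \in unitmx.
  have : symplectic n *m - symplectic n = 1%:M :> 'M[R]_(n + n).
    rewrite /symplectic opp_block_mx mulmx_block !oppr0 opprK.
    by rewrite !(mul0mx, mulmx0, mul1mx, mulmx1, add0r, addr0, mulmxN) opprK -scalar_mx_block.
  by move/mulmx1_unit; case.
have := mulmx0_rank_max h; rewrite mxrank_tr mxrankMfree ?row_free_unit //.
lia.
Qed.

Definition no_imaginary_eigenvalue n (H : 'M[R]_n) : Prop :=
  forall w a b, real_eigenpair H 0 w a b -> a = 0 /\ b = 0.

(** Both the stable and the unstable kernels are isotropic, hence of dimension at
    most n, while together they span a space of dimension 2 n. *)
Lemma stable_subspace n (H : 'M[R]_(n.+1 + n.+1)) :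
  no_imaginary_eigenvalue H -> H^T *m symplectic n.+1 = - (symplectic n.+1 *m H) ->
  exists p : {poly R}, exists V : 'M[R]_(n.+1, n.+1 + n.+1),
    [/\ forall z, root (toC p) z -> complex.Re z < 0,
      coprimep p (p \Po (- 'X)), row_free V &
      (V :=: kermxpoly H^T p)%MS].
Proof.
move=> hH hJ.
have hroots z : root (toC (char_poly H^T)) z -> complex.Re z != 0.
  rewrite map_char_poly /= -map_trmx -eigenvalue_root_char eigenvalue_trmx.
  case: z => al be /eigenvalue_pairP [a [b [hp nz]]] /=; apply/eqP => al0.
  by rewrite al0 in hp; have [a0 b0] := hH _ _ _ hp; move: nz; rewrite a0 b0 eqxx; case.
have [p1 [p2 [e12 h1 h2]]] := real_poly_split (char_poly_monic H^T) hroots.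
have c1 : coprimep p1 (p1 \Po (- 'X)).
  apply: coprimep_disjoint_roots => z /h1 z0; apply/negP; rewrite root_comp_opp => /h1.
  rewrite raddfN /=; lra.
have c2 : coprimep p2 (p2 \Po (- 'X)).
  apply: coprimep_disjoint_roots => z /h2 z0; apply/negP; rewrite root_comp_opp => /h2.
  rewrite raddfN /=; lra.
have c12 : coprimep p1 p2.
  by apply: coprimep_disjoint_roots => z /h1 z0; apply/negP => /h2; lra.
have hJ' : H^T *m symplectic n.+1 = - (symplectic n.+1 *m H^T^T) by rewrite trmxK.
have rk p : coprimep p (p \Po (- 'X)) -> (\rank (kermxpoly H^T p) <= n.+1)%N.
  move=> cp; apply: isotropic_rank; apply: (isotropic_kermxpoly hJ' cp).
  exact: mulmx_ker.
have r1 : \rank (kermxpoly H^T p1) = n.+1.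
  apply/eqP; rewrite eqn_leq rk //=.
  have := mxrank_adds_leqif (kermxpoly H^T p1) (kermxpoly H^T p2) => -[h _].
  have full : (kermxpoly H^T (char_poly H^T) :=: 1%:M)%MS.
    exact: kermxpoly_min (mxminpoly_dvd_char _).
  have := rk _ c2; move: h.
  rewrite -(kermxpolyM H^T c12) -e12 full mxrank1; lia.
exists p1, (castmx (r1, erefl) (row_base (kermxpoly H^T p1))); split=> //.
  by rewrite /row_free eqmx_cast eq_row_base r1.
apply: eqmx_trans (eqmx_cast _ _) (eq_row_base _).
Qed.

Lemma graph_mx_inj a b c (X : 'M[R]_(a, b)) (P : 'M[R]_(b, c)) :
  X *m row_mx 1%:M P = 0 -> X = 0.
Proof. by rewrite mul_mx_row mulmx1 -row_mx0 => /eq_row_mx []. Qed.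

(** The stable subspace V of the Hamiltonian matrix is the graph of P. It meets
    the vertical space trivially: for (0, y) in V, isotropy of V against the image
    of (0, y) gives y D = 0, so the Hamiltonian acts on these vectors as - A, and
    p(-A) y = 0 with p(-A) invertible because A is Hurwitz and p has its roots in
    the left half plane. Isotropy of V says that P is symmetric, invariance says
    that P solves the Riccati equation, and the restriction of the Hamiltonian
    to V is the transposed closed loop, which p annihilates. *)
Lemma stabilizing_solution_exists n k (A : 'M[R]_n) (D : 'M[R]_(n, k)) (Q : 'M[R]_n) :
  hurwitz A -> Q^T = Q ->
  no_imaginary_eigenvalue (hamiltonian A (D *m D^T) Q) ->
  exists P : 'M[R]_n, [/\ P^T = P,
    A^T *m P + P *m A + Q + P *m (D *m D^T) *m P = 0 &
    hurwitz (A + D *m D^T *m P)].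
Proof.
case: n A D Q => [|n] A D Q hA sQ hH.
  exists 0; split; last exact: hurwitz0.
    by rewrite trmx0.
  by rewrite [LHS]flatmx0.
set N := D *m D^T in hH *.
have sN : N^T = N by rewrite /N trmx_mul trmxK.
pose H := hamiltonian A N Q; pose M := H^T.
have ME : M = block_mx A^T (- Q) N (- A).
  by rewrite /M /H /hamiltonian tr_block_mx !linearN /= sQ sN trmxK.
have hJ : H^T *m symplectic n.+1 = - (symplectic n.+1 *m H).
  rewrite -/M ME /H /hamiltonian /symplectic !mulmx_block.
  rewrite !(mul0mx, mulmx0, mul1mx, mulmx1, add0r, addr0, mulNmx, mulmxN).
  by rewrite opp_block_mx !opprK.
have [p [V [hp cp fV eV]]] := stable_subspace hH hJ.
have Vp : V *m horner_mx M p = 0 by apply/sub_kermxP; rewrite eV.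
have inV m (w : 'M[R]_(m, n.+1 + n.+1)) : (w <= V)%MS = (w *m horner_mx M p == 0).
  by rewrite eV; apply/sub_kermxP/eqP.
have hJ' : M *m symplectic n.+1 = - (symplectic n.+1 *m M^T) by rewrite /M trmxK.
have iso m (w : 'M[R]_(m, n.+1 + n.+1)) : (w <= V)%MS -> w *m symplectic n.+1 *m w^T = 0.
  by rewrite inV => /eqP; exact: isotropic_kermxpoly.
have stab m (w : 'M[R]_(m, n.+1 + n.+1)) q : (w <= V)%MS -> (w *m horner_mx M q <= V)%MS.
  rewrite !inV => /eqP h; rewrite -mulmxA mulmxE (comm_horner_mx2 M q p).
  by rewrite -mulmxE mulmxA h mul0mx.
have vert (y : 'rV[R]_n.+1) : (row_mx 0 y <= V)%MS -> y = 0.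
  have rM (z : 'rV[R]_n.+1) :
      (row_mx 0 z : 'rV[R]_(n.+1 + n.+1)) *m M = row_mx (z *m N) (- (z *m A)).
    by rewrite ME mul_row_block !mul0mx !add0r mulmxN.
  have base (x : 'rV[R]_n.+1) : (row_mx 0 x <= V)%MS -> x *m N = 0.
    move=> hx; have hxM := stab _ _ 'X hx; rewrite horner_mx_X in hxM.
    have hxs : (col_mx (row_mx 0 x) (row_mx 0 x *m M) <= V)%MS.
      by rewrite col_mx_sub hx.
    have := iso _ _ hxs; rewrite mul_col_mx tr_col_mx mul_col_row.
    rewrite -[RHS](block_mx0) => /eq_block_mx [_ h _ _].
    move: h; rewrite rM /symplectic mul_row_block.
    rewrite !(mul0mx, mulmx0, add0r, addr0, mulmxN, mulmx1) tr_row_mx mul_row_col.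
    rewrite !(mul0mx, addr0, mulNmx) => /eqP; rewrite oppr_eq0 => /eqP.
    rewrite trmx_mul sN /N !mulmxA => h.
    have : sqn ((x *m D)^T) <= 0.
      by rewrite /sqn bil1E trmxK trmx_mul mulmxA h mxE.
    by move=> /sqn_eq0 /(congr1 trmx); rewrite trmxK trmx0 => ->; rewrite mul0mx.
  have act (q : {poly R}) (x : 'rV[R]_n.+1) : (row_mx 0 x <= V)%MS ->
      (row_mx 0 x : 'rV[R]_(n.+1 + n.+1)) *m horner_mx M q =
      row_mx 0 (x *m horner_mx A (q \Po (- 'X))) :> 'rV[R]_(n.+1 + n.+1).
    move=> hx; elim/poly_ind: q => [|q c IH].
      by rewrite comp_poly0 !rmorph0 !mulmx0 row_mx0.
    rewrite comp_poly_MXaddC !rmorphD !rmorphM /= rmorphN /= !horner_mx_X !horner_mx_C.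
    rewrite !mulmxDr -!mulmxE !mulmxA IH.
    have /base hz : (row_mx 0 (x *m horner_mx A (q \Po (- 'X))) <= V)%MS.
      by rewrite -IH; apply: stab.
    rewrite rM hz !mul_mx_scalar scale_row_mx scaler0.
    by apply: etrans (add_row_mx _ _ _ _) _; rewrite addr0 !mulmxN.
  move=> hy; have := act p y hy.
  have -> : (row_mx 0 y : 'rV[R]_(n.+1 + n.+1)) *m horner_mx M p = 0 :> 'rV[R]_(n.+1 + n.+1) by apply/eqP; rewrite -inV.
  rewrite -[LHS](row_mx0) => /eq_row_mx [_ /esym hyp].
  have /Bezout_eq1_coprimepP [[/= u v] uv] : coprimep (p \Po (- 'X)) (char_poly A).
    apply: coprimep_disjoint_roots => z; rewrite root_comp_opp => /hp z0.
    by apply/negP => /(hurwitz_root hA); move: z0; rewrite raddfN /=; lra.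
  have /(congr1 (fun f => y *m horner_mx A f)) := uv.
  rewrite rmorphD !rmorphM /= rmorph1 mulmx1 Cayley_Hamilton mulr0 addr0 => <-.
  rewrite (comm_horner_mx2 A u (p \Po (- 'X))) -mulmxE mulmxA hyp mul0mx //.
pose X1 := lsubmx V; pose X2 := rsubmx V.
have VE : V = row_mx X1 X2 by rewrite hsubmxK.
have uX1 : X1 \in unitmx.
  rewrite -row_free_unit; apply: inj_row_free => v v0.
  have vV : v *m V = row_mx 0 (v *m X2) by rewrite VE mul_mx_row v0.
  have /vert y0 : (row_mx 0 (v *m X2) <= V)%MS by rewrite -vV submxMl.
  by apply: (row_free_inj fV); rewrite vV y0 row_mx0 mul0mx.
pose P := invmx X1 *m X2.
pose W := row_mx 1%:M P.
have WE : W = invmx X1 *m V by rewrite VE mul_mx_row mulVmx.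
have hW : (W <= V)%MS by rewrite WE submxMl.
have VW : V = X1 *m W by rewrite WE mulKVmx.
have sP : P^T = P.
  have := iso _ _ hW; rewrite /W /symplectic mul_row_block.
  rewrite !(mul1mx, mulmx0, add0r, addr0, mulmxN, mulmx1) tr_row_mx mul_row_col trmx1 mulmx1 mul1mx.
  by move/eqP; rewrite addrC subr_eq0 => /eqP.
have [L hL] : exists L, W *m M = L *m W.
  have := stab _ _ 'X hW; rewrite horner_mx_X VW => /submxP [L ->].
  by exists (L *m X1); rewrite mulmxA.
move: (hL); rewrite /W ME mul_row_block mul_mx_row !mul1mx mulmx1.
move=> /eq_row_mx [eL eP].
have Lp : horner_mx L p = 0.
  apply: (@graph_mx_inj _ _ _ _ P).
  by apply: etrans (esym (horner_mx_intertwine p hL)) _; apply/eqP; rewrite -inV.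
exists P; split; first exact: sP.
  have : A^T *m P + P *m N *m P - (- Q + P *m - A) = 0.
    by rewrite eP -eL mulmxDl subrr.
  rewrite mulmxN opprB opprK => <-.
  by rewrite -!addrA; congr (_ + _); rewrite addrA addrC.
have -> : A + N *m P = L^T by rewrite -eL linearD /= trmxK trmx_mul sN sP.
by apply: hurwitz_trmx; apply: hurwitz_annihilated Lp hp.
Qed.

End Graph.

(** * Square roots of positive semidefinite real matrices *)

Section SquareRoot.
Context {R : realType}.
Local Open Scope complex_scope.
Local Open Scope sesquilinear_scope.
Local Open Scope ring_scope.

Lemma conjC_Complex (a b : R) : Num.conj (Complex a b) = Complex a (- b).
Proof. by []. Qed.

Lemma adj_complex_mx p q (M : 'M[R]_(p, q)) : (complex_mx M)^t* = complex_mx M^T.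
Proof. by apply/matrixP => i j; rewrite !mxE conjC_Complex oppr0. Qed.

Lemma adj_mulmx p q r (M : 'M[R[i]]_(p, q)) (N : 'M[R[i]]_(q, r)) :
  (M *m N)^t* = N^t* *m M^t*.
Proof. by rewrite trmx_mul map_mxM. Qed.

Lemma complex_mxM p q r (M : 'M[R]_(p, q)) (N : 'M[R]_(q, r)) :
  complex_mx (M *m N) = complex_mx M *m complex_mx N.
Proof. exact: map_mxM. Qed.

Lemma complex_mx_inj p q (M N : 'M[R]_(p, q)) : complex_mx M = complex_mx N -> M = N.
Proof. by move=> /matrixP h; apply/matrixP => i j; have := h i j; rewrite !mxE => -[]. Qed.

Lemma cform_pair n (X : 'M[R]_n) (a b : 'cV[R]_n) :
  ((cpair a b)^t* *m complex_mx X *m cpair a b) ord0 ord0 =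
  Complex (bil X a a + bil X b b) (bil X a b - bil X b a).
Proof.
rewrite -mulmxA complex_mulmx !mxE.
rewrite /bil -!mulmxA !mxE -sumrB -big_split /= -complex_sum.
apply: eq_bigr => k _; rewrite !mxE conjC_Complex.
by apply/eqP; rewrite eq_complex /=; apply/andP; split; apply/eqP; ring.
Qed.

Lemma interpolation (s : seq R) (f : R -> R) :
  exists p : {poly R}, forall x, x \in s -> p.[x] = f x.
Proof.
elim: s => [|x s [p hp]]; first by exists 0.
have [xs|xs] := boolP (x \in s).
  by exists p => y; rewrite inE => /orP[/eqP ->|]; apply: hp.
pose q := \prod_(y <- s) ('X - y%:P).
have qx : q.[x] != 0 by rewrite -[_ == 0]/(root q x) root_prod_XsubC.
exists (p + ((f x - p.[x]) / q.[x]) *: q) => y; rewrite inE hornerD hornerZ.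
case/orP => [/eqP ->|ys]; first by rewrite divfK // addrC subrK.
by have /rootP -> : root q y; rewrite ?root_prod_XsubC // mulr0 addr0 hp.
Qed.

(** The square root is T^2 for a real polynomial T in Q that takes the value of the
    fourth root at the eigenvalues of Q: then T is symmetric and T^2 = T^T T is
    positive semidefinite. The spectral theorem over the complex numbers gives
    T^4 = Q. *)
Lemma psd_sqrt n (Q : 'M[R]_n) : possemidef Q ->
  exists S : 'M[R]_n, possemidef S /\ S *m S = Q.
Proof.
case: n Q => [|n] Q [sQ pQ].
  exists 0; split; last by rewrite [LHS]flatmx0 [RHS]flatmx0.
  by split=> [|x]; [rewrite /symmetric_mx trmx0|rewrite mulmx0 mul0mx mxE].
pose Qc := complex_mx Q.
have nQ : Qc \is normalmx.
  by apply/normalmxP; rewrite /Qc adj_complex_mx sQ.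
have /orthomx_spectralP := nQ.
set U := spectralmx Qc; set sp := spectral_diag Qc => eQ.
have uU : U \is unitarymx := spectral_unitarymx Qc.
have iU : U \in unitmx := unitarymx_unit uU.
have UQ : U *m Qc = diag_mx sp *m U by rewrite {1}eQ !mulmxA mulmxV // mul1mx.
have hsp j : exists2 t : R, 0 <= t & sp ord0 j = Complex t 0.
  have [a [b eab]] := cpairP ((row j U)^t*).
  have := cform_pair Q a b; rewrite -eab trmxCK (bil_sym a b sQ) subrr => e.
  exists (bil Q a a + bil Q b b); first by apply: addr_ge0; apply: pQ.
  rewrite -e -/Qc.
  have -> : (row j U *m Qc *m (row j U)^t*) ord0 ord0 = (U *m Qc *m U^t*) j j.
    by rewrite -row_mul !mxE; apply: eq_bigr => k _; rewrite !mxE.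
  by rewrite UQ -mulmxA (unitarymxP uU) mulmx1 mxE eqxx mulr1n.
pose f (j : 'I_n.+1) : R := complex.Re (sp ord0 j).
have f0 j : 0 <= f j by rewrite /f; have [t t0 ->] := hsp j.
have spf j : sp ord0 j = (f j)%:C by rewrite /f; have [t t0 ->] := hsp j.
have [q hq] := interpolation [seq f j | j <- enum 'I_n.+1] (fun x => Num.sqrt (Num.sqrt x)).
pose T := horner_mx Q q.
have sT : T^T = T by rewrite /T -horner_mx_tr sQ.
have hT : T *m T *m (T *m T) = Q.
  pose E := diag_mx (map_mx (fun z => Complex (Num.sqrt (Num.sqrt (complex.Re z))) 0) sp).
  have UT : U *m complex_mx T = E *m U.
    rewrite /complex_mx map_horner_mx (horner_mx_intertwine _ UQ) horner_mx_diag.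
    congr (diag_mx _ *m U); apply/rowP => j; rewrite !mxE spf horner_map /= hq //.
    by apply: map_f; rewrite mem_enum.
  have EE : E *m E *m (E *m E) = diag_mx sp.
    rewrite /E !mulmx_diag; congr diag_mx; apply/rowP => j; rewrite !mxE spf.
    have -> (x : R) : Complex x 0 * Complex x 0 * (Complex x 0 * Complex x 0) = Complex (x ^+ 2 ^+ 2) 0.
      by apply/eqP; rewrite eq_complex /=; apply/andP; split; apply/eqP; ring.
    by rewrite /= !sqr_sqrtr ?sqrtr_ge0.
  apply: complex_mx_inj; apply: (can_inj (mulKmx iU)).
  rewrite !complex_mxM -/Qc UQ -EE !mulmxA UT -!mulmxA; congr (E *m _).
  by rewrite !mulmxA UT -!mulmxA; congr (E *m _); rewrite !mulmxA UT -!mulmxA UT.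
exists (T *m T); split=> //; split=> [|x].
  by rewrite /symmetric_mx trmx_mul sT.
by have := sqn_ge0 (T *m x); rewrite sqn_mul sT.
Qed.

End SquareRoot.

(** * The bounded real lemma *)

Section BoundedReal.
Context {R : realType}.

Lemma sqn_mul_bound p q (M : 'M[R]_(p, q)) x : sqn (M *m x) <= nrm (M^T *m M) * sqn x.
Proof.
by rewrite sqn_mul; have := bil_bound (M^T *m M) x; rewrite ler_norml => /andP[].
Qed.

Lemma scaled_gram n k (D : 'M[R]_(n, k)) (gamma : R) :
  gamma^-1 *: D *m (gamma^-1 *: D)^T = gamma ^- 2 *: (D *m D^T).
Proof. by rewrite linearZ /= -scalemxAl -scalemxAr scalerA -exprVn expr2. Qed.

Lemma riccati_form n k (A P Q : 'M[R]_n) (D : 'M[R]_(n, k)) (g : R) (x : 'cV[R]_n) :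
  P^T = P ->
  bil (A^T *m P + P *m A + Q + g *: (P *m D *m D^T *m P)) x x =
  2 * bil P x (A *m x) + bil Q x x + g * sqn (D^T *m P *m x).
Proof.
move=> sP; rewrite !bilDm bilZm bil_mull trmxK (bil_sym _ _ sP) bil_mulr.
have -> : bil (P *m D *m D^T *m P) x x = sqn (D^T *m P *m x).
  by rewrite sqn_mul trmx_mul trmxK sP !mulmxA.
ring.
Qed.

(** The hypotheses on x and u are the real and imaginary parts of
    (i w - A) x = D u. With p = D^T P x and v = u - gamma^-2 p, completion of
    squares in the Riccati equation gives x^* Q x = gamma^2 (|u|^2 - |v|^2). The
    relation also reads (i w - G) x = D v with G the Hurwitz closed loop; a
    Lyapunov certificate for G bounds |x|, hence |u|, by a multiple of |v| that
    does not depend on w. *)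
Lemma strict_gain n k (A P Q : 'M[R]_n) (D : 'M[R]_(n, k)) (gamma : R) :
  0 < gamma -> P^T = P ->
  A^T *m P + P *m A + Q + gamma ^- 2 *: (P *m D *m D^T *m P) = 0 ->
  hurwitz (A + gamma ^- 2 *: (D *m D^T *m P)) ->
  exists2 del : R, 0 < del & forall (w : R) (x1 x2 : 'cV[R]_n) (u1 u2 : 'cV[R]_k),
    - (w *: x2) - A *m x1 = D *m u1 -> w *: x1 - A *m x2 = D *m u2 ->
    bil Q x1 x1 + bil Q x2 x2 <= (gamma ^+ 2 - del) * (sqn u1 + sqn u2).
Proof.
move=> g0 sP ric hG.
have [Y [sY pY] hY] := hurwitz_certificate hG.
set g := gamma ^- 2 in ric hG hY; set G := A + _ in hG hY.
have gpos : 0 < g by rewrite invr_gt0 exprn_gt0.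
have gg : gamma ^+ 2 * g = 1 by rewrite /g divff // gt_eqF // exprn_gt0.
pose F := D^T *m P; pose Z := Y *m D.
pose c1 := nrm (F^T *m F); pose c2 := nrm (Z^T *m Z).
have c10 : 0 <= c1 := nrm_ge0 _.
have c20 : 0 <= c2 := nrm_ge0 _.
pose kap := 2 + 2 * g ^+ 2 * c1 * (4 * c2).
have kap0 : 0 < kap.
  have := mulr_ge0 (mulr_ge0 (sqr_ge0 g) c10) c20; rewrite /kap; lra.
exists (gamma ^+ 2 / kap) => [|w x1 x2 u1 u2 e1 e2].
  by rewrite divr_gt0 // exprn_gt0.
have ricx x : 2 * bil P x (A *m x) + bil Q x x + g * sqn (F *m x) = 0.
  by rewrite -riccati_form // ric bil0m.
pose w1 := u1 - g *: (F *m x1); pose w2 := u2 - g *: (F *m x2).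
have Ax1 : A *m x1 = - (w *: x2) - D *m u1 by rewrite -e1 opprB addrC subrK.
have Ax2 : A *m x2 = w *: x1 - D *m u2 by rewrite -e2 opprB addrC subrK.
have GE (x : 'cV[R]_n) : G *m x = A *m x + g *: (D *m (F *m x)).
  by rewrite /G mulmxDl -scalemxAl /F !mulmxA.
have Gx1 : G *m x1 = - (w *: x2) - D *m w1.
  by rewrite GE Ax1 /w1 mulmxBr -scalemxAr opprB addrA addrAC.
have Gx2 : G *m x2 = w *: x1 - D *m w2.
  by rewrite GE Ax2 /w2 mulmxBr -scalemxAr opprB addrA addrAC.
have PD x u : bil P x (D *m u) = bil 1%:M (F *m x) u.
  by rewrite !bil1E /F !trmx_mul trmxK sP /bil !mulmxA.
have r1 := ricx x1; have r2 := ricx x2.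
rewrite Ax1 !bilE PD in r1; rewrite Ax2 !bilE PD (bil_sym x2 x1 sP) in r2.
have y1 := hY x1; have y2 := hY x2.
rewrite Gx1 !bilE in y1; rewrite Gx2 !bilE (bil_sym x2 x1 sY) in y2.
have YD x u : 2 * bil Y x (D *m u) <= 1 / 2 * sqn x + 2 * (c2 * sqn u).
  have -> : bil Y x (D *m u) = bil 1%:M x (Z *m u).
    by rewrite bil1E /Z /bil !mulmxA.
  have := sqn_ge0 (x - 2 *: (Z *m u)); have := sqn_mul_bound Z u.
  rewrite /sqn !bilE (bilC1 (Z *m u) x) -/c2; lra.
have z1 := YD x1 w1; have z2 := YD x2 w2.
have xw : sqn x1 + sqn x2 <= 4 * c2 * (sqn w1 + sqn w2) by lra.
have f1 := sqn_mul_bound F x1; have f2 := sqn_mul_bound F x2.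
have uw (u f : 'cV[R]_k) : sqn u <= 2 * sqn (u - g *: f) + 2 * g ^+ 2 * sqn f.
  have := sqn_ge0 (u - 2 *: (g *: f)).
  by rewrite /sqn !bilE (bilC1 f u); lra.
have v1 := uw u1 (F *m x1); have v2 := uw u2 (F *m x2).
have uk : sqn u1 + sqn u2 <= kap * (sqn w1 + sqn w2).
  have h : 2 * g ^+ 2 * (sqn (F *m x1) + sqn (F *m x2)) <=
      2 * g ^+ 2 * (c1 * (4 * c2 * (sqn w1 + sqn w2))).
    rewrite ler_wpM2l ?mulr_ge0 ?exprn_ge0 ?(ltW gpos) //.
    apply: (@le_trans _ _ (c1 * (sqn x1 + sqn x2))); first by rewrite mulrDr lerD.
    by rewrite ler_wpM2l.
  rewrite -/w1 in v1; rewrite -/w2 in v2; rewrite /kap; lra.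
have we (u f : 'cV[R]_k) : gamma ^+ 2 * sqn (u - g *: f) =
    gamma ^+ 2 * sqn u - 2 * bil 1%:M f u + g * sqn f.
  have -> : gamma ^+ 2 * sqn (u - g *: f) = gamma ^+ 2 * sqn u -
      gamma ^+ 2 * g * 2 * bil 1%:M f u + gamma ^+ 2 * g * (g * sqn f).
    by rewrite /sqn !bilE (bilC1 u f); ring.
  by rewrite gg; ring.
have h1 := we u1 (F *m x1); have h2 := we u2 (F *m x2).
rewrite -/w1 in h1; rewrite -/w2 in h2.
have uk2 : gamma ^+ 2 / kap * (sqn u1 + sqn u2) <= gamma ^+ 2 * (sqn w1 + sqn w2).
  rewrite -mulrA ler_wpM2l ?exprn_ge0 ?(ltW g0) //.
  by rewrite ler_pdivrMl.
lra.
Qed.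

End BoundedReal.

Section Transfer.
Context {R : realType} {m d l n : nat}.
Local Open Scope complex_scope.
Local Open Scope sesquilinear_scope.
Local Open Scope ring_scope.
Variables (A : 'M[R]_m) (B : 'M[R]_(m, d)) (C : 'M[R]_(l, m)) (D : 'M[R]_(m, n)).
Variables (Rw : 'M[R]_d) (gamma : R).
Hypothesis hRw : posdef Rw.
Hypothesis g0 : 0 < gamma.
Implicit Types K : 'M[R]_(d, m).

Lemma posdef_psd p (X : 'M[R]_p) : posdef X -> possemidef X.
Proof.
move=> [sX pX]; split=> // x; have [->|/pX /ltW //] := eqVneq x 0.
by have := bil0r X 0; rewrite /bil => ->.
Qed.

Lemma state_cost_form K x :
  bil (state_cost C Rw K) x x = sqn (C *m x) + bil Rw (K *m x) (K *m x).
Proof.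
by rewrite /state_cost bilDm -sqn_mul bil_mulr bil_mull trmxK.
Qed.

Lemma state_cost_psd K : possemidef (state_cost C Rw K).
Proof.
have [sR pR] := posdef_psd hRw; split.
  by rewrite /symmetric_mx linearD /= !trmx_mul !trmxK sR mulmxA.
move=> x; have := state_cost_form K x; rewrite {1}/bil => ->.
by rewrite addr_ge0 ?sqn_ge0 //; exact: pR.
Qed.

Lemma sqrt_state_cost K : let S := sqrt_mx (state_cost C Rw K) in
  S^T = S /\ S *m S = state_cost C Rw K.
Proof.
have [S hS] := psd_sqrt (state_cost_psd K).
have := @xgetPex _ 0 [set S | possemidef S /\ S *m S = state_cost C Rw K]%classic
  (ex_intro _ S hS).
by case=> -[].
Qed.

Lemma resolvent_unit (G : 'M[R]_m) w : hurwitz G ->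
  (Complex 0 w)%:M - complex_mx G \in unitmx.
Proof.
move=> hG; rewrite -row_free_unit -kermx_eq0.
apply: contraT => nz.
have : eigenvalue (complex_mx G) (Complex 0 w).
  rewrite /eigenvalue /eigenspace; apply: contraNneq nz => h.
  by rewrite -[_ - _]opprB kermx_eq0 /row_free mxrank_opp -/(row_free _) -kermx_eq0 h.
by move=> /hG /=; rewrite ltxx.
Qed.

Lemma resolvent_pair (G : 'M[R]_m) w x1 x2 : 
  ((Complex 0 w)%:M - complex_mx G) *m cpair x1 x2 =
  cpair (- (w *: x2) - G *m x1) (w *: x1 - G *m x2) :> 'cV_m.
Proof.
by rewrite mulmxBl mul_scalar_mx complex_mulmx cpairZ cpairB !scale0r sub0r addr0.
Qed.

Lemma gram_factor a b c e (S : 'M[R[i]]_(a, b)) (Z : 'M[R[i]]_b) (T : 'M[R[i]]_(b, c))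
    (u : 'M[R[i]]_(c, e)) :
  (S *m Z *m T)^t* *m (S *m Z *m T) *m u =
  T^t* *m Z^t* *m (S^t* *m S) *m (Z *m T *m u).
Proof. by rewrite !adj_mulmx !mulmxA. Qed.

(** At u, with x = (i w - A_K)^-1 D u, the Gram matrix of the transfer function
    involves the square root of the state cost only through its square. *)
Lemma transfer_gram K w (u : 'cV[R[i]]_n) :
  let G := transfer A B C D Rw K (0 +i* w) in
  let Z := (Complex 0 w)%:M - complex_mx (A - B *m K) in
  G^t* *m G *m u =
  complex_mx D^T *m (invmx Z)^t* *m complex_mx (state_cost C Rw K) *m
    (invmx Z *m complex_mx D *m u).
Proof.
have [sS eS] := sqrt_state_cost K.
by rewrite /transfer gram_factor !adj_complex_mx sS -complex_mxM eS.
Qed.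

(** [strict_gain] bounds every squared singular value by gamma^2 - del, at all
    frequencies, so the supremum stays below gamma. *)
Lemma hinf_norm_lt K P : hurwitz (A - B *m K) ->
  stabilizing_solution A B C D Rw gamma K P -> (hinf_norm A B C D Rw K < gamma%:E)%E.
Proof.
move=> hA [[sP pP] ric hG].
have [del del0 gain] := strict_gain g0 sP ric hG.
pose bound := Num.sqrt (gamma ^+ 2 - del).
have lt_bound : bound < gamma.
  rewrite -[X in _ < X]gtr0_norm // -sqrtr_sqr ltr_sqrt ?exprn_gt0 //; lra.
apply: (@le_lt_trans _ _ bound%:E); last by rewrite lte_fin.
apply: ge_ereal_sup => _ [w _ <-]; rewrite lee_fin.
rewrite /sigma_max; set SV := [set s | _]%classic.
(* no singular value when the input space is trivial: the supremum is then 0 *)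
have [->|/set0P ne] := eqVneq SV set0%classic; first by rewrite sup0 sqrtr_ge0.
apply: ge_sup => // s [s0 /eigen_colP [u nz hu]].
rewrite -[s]ger0_norm // -sqrtr_sqr; apply: ler_wsqrtr.
have hgram := transfer_gram K w u; rewrite /= hu in hgram.
set Z := (Complex 0 w)%:M - _ in hgram.
have uZ : Z \in unitmx := resolvent_unit w hA.
set x := invmx Z *m complex_mx D *m u in hgram.
have Zx : Z *m x = complex_mx D *m u by rewrite /x !mulmxA mulmxV // mul1mx.
have [u1 [u2 eu]] := cpairP u; have [x1 [x2 ex]] := cpairP x.
move: Zx; rewrite {1}ex {1}eu resolvent_pair complex_mulmx => /cpair_inj [e1 e2].
have := gain _ _ _ _ _ e1 e2.
have ux : u^t* *m complex_mx D^T *m (invmx Z)^t* = x^t*.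
  by rewrite /x !adj_mulmx adj_complex_mx !mulmxA.
have : (u^t* *m ((s ^+ 2)%:C *: u)) ord0 ord0 =
    (x^t* *m complex_mx (state_cost C Rw K) *m x) ord0 ord0.
  by rewrite hgram !mulmxA ux.
rewrite -scalemxAr mxE ex cform_pair.
have -> : (u^t* *m u) ord0 ord0 = Complex (sqn u1 + sqn u2) 0.
  rewrite -[u^t*]mulmx1 -[1%:M](map_mx1 (real_complex R)) eu cform_pair.
  by rewrite (bilC1 u1 u2) subrr.
move=> /(congr1 (@complex.Re R)) /=; rewrite mulr0 subr0 => <-.
rewrite ler_pM2r // lt_neqAle addr_ge0 ?sqn_ge0 // andbT eq_sym.
apply: contraNneq nz => z0; rewrite eu.
have := sqn_ge0 u1; have := sqn_ge0 u2 => a1 a2.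
have u10 : u1 = 0 by apply: sqn_eq0; lra.
have u20 : u2 = 0 by apply: sqn_eq0; lra.
by rewrite u10 u20 cpair00.
Qed.

Lemma singular_value_bounded p q (G : 'M[R[i]]_(p, q)) :
  has_ubound [set s | singular_value G s].
Proof.
have [rs e] := closed_field_poly_normal (char_poly (G^t* *m G)).
move: e; have /monicP -> := char_poly_monic (G^t* *m G); rewrite scale1r => e.
exists (1 + \sum_(z <- rs) `|complex.Re z|) => s [s0].
rewrite eigenvalue_root_char e root_prod_XsubC => hs.
have : s ^+ 2 <= \sum_(z <- rs) `|complex.Re z|.
  rewrite (big_rem _ hs) /= ger0_norm ?exprn_ge0 // lerDl sumr_ge0 //.
nra.
Qed.

(** For an eigenvector (x, y) of the Hamiltonian at i w put u = gamma^-2 D^T y.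
    The two block rows read (i w - A_K) x = D u and (i w - A_K)^* y = Q x, so that
    T^* T u = D^T y = gamma^2 u. Unless u = 0, which kills x and then y, gamma is
    a singular value of T at the frequency w. *)
Lemma feasible_no_imaginary K : feasible A B C D Rw gamma K ->
  no_imaginary_eigenvalue
    (hamiltonian (A - B *m K) (gamma^-1 *: D *m (gamma^-1 *: D)^T) (state_cost C Rw K)).
Proof.
move=> [hA hlt] w a b [].
rewrite -[a]vsubmxK -[b]vsubmxK.
set x1 := usubmx a; set y1 := dsubmx a; set x2 := usubmx b; set y2 := dsubmx b.
rewrite !mul_block_col !scale_col_mx opp_col_mx !add_col_mx !scale0r !add0r !addr0.
rewrite scaled_gram.
set F := A - B *m K in hA *; set Q := state_cost C Rw K.
move=> /eq_col_mx [e1 e2] /eq_col_mx [e3 e4].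
pose x := cpair x1 x2; pose y := cpair y1 y2.
pose Z := (Complex 0 w)%:M - complex_mx F.
have uZ : Z \in unitmx := resolvent_unit w hA.
pose u := complex_mx (gamma ^- 2 *: D^T) *m y.
have Zx : Z *m x = complex_mx D *m u.
  rewrite resolvent_pair /u mulmxA -complex_mxM complex_mulmx; congr cpair.
    by rewrite -e1 -scalemxAr addrAC subrr add0r.
  by rewrite -e3 -scalemxAr addrAC subrr add0r.
have Zy : Z^t* *m y = complex_mx Q *m x.
  have -> : Z^t* = (Complex 0 (- w))%:M - complex_mx F^T.
    rewrite /Z -[in LHS]opprB linearN linearB /= map_mxN map_mxB /= opprB tr_scalar_mx.
    by rewrite map_scalar_mx /= conjC_Complex -adj_complex_mx.
  rewrite mulmxBl mul_scalar_mx !complex_mulmx cpairZ cpairB !scale0r sub0r addr0 scaleNr opprK.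
  rewrite scaleNr; congr cpair.
    by rewrite !mulNmx in e2; rewrite -[w *: y2]opprK -e2 opprD !opprK addrK.
  by rewrite !mulNmx in e4; rewrite -e4 opprD !opprK addrK.
have xE : x = invmx Z *m complex_mx D *m u by rewrite -mulmxA -Zx mulKmx.
have yE : y = (invmx Z)^t* *m (complex_mx Q *m x).
  by rewrite -Zy mulmxA -adj_mulmx mulmxV // trmx1 map_mx1 mul1mx.
have x0y0 : u = 0 -> x = 0 /\ y = 0.
  move=> u0; have x0 : x = 0 by rewrite xE u0 mulmx0.
  by split=> //; rewrite yE x0 !mulmx0.
have [u0|nz] := eqVneq u 0.
  have [/cpair_eq0 [-> ->] /cpair_eq0 [-> ->]] := x0y0 u0.
  by rewrite col_mx0.
exfalso; move: hlt; apply/negP; rewrite -leNgt.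
apply: le_trans (ereal_sup_ubound _); last by exists w.
rewrite lee_fin /sigma_max; apply: ub_le_sup; first exact: singular_value_bounded.
split; first exact: ltW.
apply/eigen_colP; exists u => //.
rewrite transfer_gram // -xE -/F -/Z -/Q -!mulmxA -yE /u.
rewrite scalemxAl; congr (_ *m _); apply/matrixP => i j; rewrite !mxE.
by rewrite -rmorphM /= mulrA divff ?mul1r // gt_eqF // exprn_gt0.
Qed.

Lemma stabilizing_of_no_imaginary K : hurwitz (A - B *m K) ->
  no_imaginary_eigenvalue
    (hamiltonian (A - B *m K) (gamma^-1 *: D *m (gamma^-1 *: D)^T) (state_cost C Rw K)) ->
  exists P, stabilizing_solution A B C D Rw gamma K P.
Proof.
move=> hA hH; have [sQ pQ] := state_cost_psd K.
have [P [sP ric hG]] := stabilizing_solution_exists hA sQ hH.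
exists P; split.
- apply: (lyapunov_ge0 hA sP) => x.
  have := bil0m x x; rewrite -ric scaled_gram -scalemxAr -scalemxAl !mulmxA riccati_form //.
  have := pQ x; rewrite -/(bil _ _ _).
  have : 0 <= gamma ^- 2 * sqn (D^T *m P *m x).
    by rewrite mulr_ge0 ?sqn_ge0 // invr_ge0 exprn_ge0 // ltW.
  lra.
- by move: ric; rewrite scaled_gram -scalemxAr -scalemxAl !mulmxA.
- by move: hG; rewrite scaled_gram -scalemxAl.
Qed.

Lemma feasible_stabilizing K : feasible A B C D Rw gamma K ->
  stabilizing_solution A B C D Rw gamma K (riccati_sol A B C D Rw gamma K).
Proof.
move=> hK; have [P hP] := stabilizing_of_no_imaginary hK.1 (feasible_no_imaginary hK).
exact: (@xgetPex _ 0 [set P | stabilizing_solution A B C D Rw gamma K P]%classic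
  (ex_intro _ P hP)).
Qed.

End Transfer.

(** * Constants attached to positive matrices *)

Section PsdBounds.
Context {R : realType}.

Lemma bil_delta p (X : 'M[R]_p) i j :
  bil X (delta_mx i ord0) (delta_mx j ord0) = X i j.
Proof. by rewrite /bil trmx_delta -rowE -colE !mxE. Qed.

Lemma sqn_delta p i : sqn (delta_mx i ord0 : 'cV[R]_p) = 1.
Proof. by rewrite /sqn bil_delta mxE eqxx. Qed.

Lemma trace_bil p (X : 'M[R]_p) : \tr X = \sum_i bil X (delta_mx i ord0) (delta_mx i ord0).
Proof. by apply: eq_bigr => i _; rewrite bil_delta. Qed.

Lemma psd_trace_ge0 p (X : 'M[R]_p) : possemidef X -> 0 <= \tr X.
Proof. by move=> [_ pX]; rewrite trace_bil sumr_ge0 // => i _; exact: pX. Qed.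

Lemma psd_entry p (X : 'M[R]_p) i j : possemidef X -> `|X i j| <= \tr X.
Proof.
move=> [sX pX].
have diag k : X k k <= \tr X.
  rewrite /mxtrace (bigD1 k) //= lerDl sumr_ge0 // => l _.
  by rewrite -bil_delta; exact: pX.
have di := diag i; have dj := diag j.
have h1 : 0 <= bil X (delta_mx i ord0 + delta_mx j ord0) (delta_mx i ord0 + delta_mx j ord0).
  exact: pX.
have h2 : 0 <= bil X (delta_mx i ord0 - delta_mx j ord0) (delta_mx i ord0 - delta_mx j ord0).
  exact: pX.
move: h1 h2; rewrite !bilE (bil_sym (delta_mx j _) (delta_mx i _) sX) !bil_delta => h1 h2.
rewrite ler_norml; apply/andP; split; lra.
Qed.

Lemma psd_trace_mul p (X G : 'M[R]_p) : possemidef X ->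
  `|\tr (X *m G)| <= nrm G * \tr X.
Proof.
move=> pX; rewrite -nrm_tr /nrm mulr_suml.
apply: le_trans (ler_norm_sum _ _ _) _; apply: ler_sum => i _.
rewrite mxE mulr_suml; apply: le_trans (ler_norm_sum _ _ _) _.
apply: ler_sum => j _; rewrite mxE normrM mulrC ler_wpM2l //.
exact: psd_entry.
Qed.

Lemma psd_nrm p (X : 'M[R]_p) : possemidef X -> nrm X <= p%:R * p%:R * \tr X.
Proof.
move=> pX; apply: (@le_trans _ _ (\sum_(i < p) \sum_(j < p) \tr X)).
  by apply: ler_sum => i _; apply: ler_sum => j _; exact: psd_entry.
by rewrite !sumr_const !card_ord -mulrnA -[_ *+ (p * p)]mulr_natl natrM.
Qed.

(** Nonnegativity of X at x - k^-1 X x. *)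
Lemma psd_image_bound p (X : 'M[R]_p) (k : R) : possemidef X -> 0 < k ->
  (forall x, bil X x x <= k * sqn x) -> forall x, sqn (X *m x) <= k * bil X x x.
Proof.
move=> [sX pX] k0 hk x.
have ki : k * k^-1 = 1 by rewrite divff // gt_eqF.
have : 0 <= bil X (x - k^-1 *: (X *m x)) (x - k^-1 *: (X *m x)) by exact: pX.
rewrite !bilE (bil_sym (X *m x) x sX).
have -> : bil X x (X *m x) = sqn (X *m x).
  by rewrite sqn_mul sX -bil_mulr.
have : k^-1 ^+ 2 * bil X (X *m x) (X *m x) <= k^-1 ^+ 2 * (k * sqn (X *m x)).
  by rewrite ler_wpM2l ?sqr_ge0.
have -> : k^-1 ^+ 2 * (k * sqn (X *m x)) = (k * k^-1) * k^-1 * sqn (X *m x) by ring.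
rewrite ki => h1 h2.
have h3 : k^-1 * sqn (X *m x) <= bil X x x by lra.
have := ler_wpM2l (ltW k0) h3; rewrite mulrA ki mul1r //.
Qed.

Lemma posdef_unit p (X : 'M[R]_p) : posdef X -> X \in unitmx.
Proof.
move=> [sX pX]; rewrite -unitmx_tr -row_free_unit; apply: inj_row_free => v hv.
apply/eqP; apply: contraT => nz.
have := pX v^T; rewrite trmx_eq0 => /(_ nz).
by rewrite trmxK -[X]sX -mulmxA mulmxA hv mul0mx mxE ltxx.
Qed.

(** [psd_image_bound] bounds |X x|^2 by the form, and |x| <= |X^-1| |X x|. *)
Lemma posdef_lower p (X : 'M[R]_p) : posdef X ->
  exists2 r : R, 0 < r & forall x, r * sqn x <= bil X x x.
Proof.
move=> hX; have uX := posdef_unit hX; have psX := posdef_psd hX.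
pose k := nrm X + 1; have k0 : 0 < k by have := nrm_ge0 X; rewrite /k; lra.
have hk x : bil X x x <= k * sqn x.
  have := bil_bound X x; have := sqn_ge0 x; rewrite ler_norml /k => h /andP[_]; lra.
pose q := nrm ((invmx X)^T *m invmx X) + 1.
have q0 : 0 < q by have := nrm_ge0 ((invmx X)^T *m invmx X); rewrite /q; lra.
exists (q * k)^-1 => [|x]; first by rewrite invr_gt0 mulr_gt0.
rewrite ler_pdivrMl ?mulr_gt0 // -mulrA.
have h1 := psd_image_bound psX k0 hk x.
have h2 := sqn_mul_bound (invmx X) (X *m x); rewrite mulKmx // in h2.
have h3 := sqn_ge0 (X *m x).
apply: (@le_trans _ _ (q * sqn (X *m x))); first by rewrite /q; lra.
by rewrite ler_wpM2l // ltW.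
Qed.

Lemma frob_sqr p q (M : 'M[R]_(p, q)) :
  frob_norm M ^+ 2 = \sum_j sqn (M *m delta_mx j ord0).
Proof.
rewrite /frob_norm sqr_sqrtr; last first.
  by apply: sumr_ge0 => i _; apply: sumr_ge0 => j _; exact: sqr_ge0.
rewrite exchange_big; apply: eq_bigr => j _; rewrite sqnE; apply: eq_bigr => i _.
by rewrite -colE mxE.
Qed.

Lemma frob_col p (x : 'cV[R]_p) : frob_norm x = Num.sqrt (sqn x).
Proof.
rewrite /frob_norm sqnE; congr Num.sqrt; apply: eq_bigr => i _.
by rewrite big_ord_recl big_ord0 addr0.
Qed.

(** [fine] sends infinite values to 0, so nu := fine (op_norm X) is the operator
    norm. The form bound follows from |X x| <= nu |x| by expanding |X x - nu x|^2. *)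
Lemma op_norm_form p (X : 'M[R]_p) : possemidef X -> 0 < fine (op_norm X) ->
  forall x, bil X x x <= fine (op_norm X) * sqn x.
Proof.
move=> [sX pX]; set nu := fine _ => nu0 x.
have enu : op_norm X = nu%:E by move: nu0; rewrite /nu; case: (op_norm X) => //= ; rewrite ltxx.
have unit_bound z : sqn z <= 1 -> sqn (X *m z) <= nu ^+ 2.
  move=> hz; have : ((frob_norm (X *m z))%:E <= op_norm X)%E.
    apply: ereal_sup_ubound; exists z => //=; rewrite frob_col -[leRHS]sqrtr1.
    exact: ler_wsqrtr.
  rewrite enu lee_fin frob_col => h; have := sqr_sqrtr (sqn_ge0 (X *m z)) => <-.
  have := sqrtr_ge0 (sqn (X *m z)) => h0; nra.
have sq : sqn (X *m x) <= nu ^+ 2 * sqn x.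
  have [->|nz] := eqVneq x 0; first by rewrite mulmx0 !sqn0 mulr0.
  have s0 : 0 < sqn x.
    by rewrite lt_neqAle sqn_ge0 andbT eq_sym; apply: contraNneq nz => s0; rewrite (@sqn_eq0 _ _ x) ?s0.
  pose t := Num.sqrt (sqn x); have t0 : 0 < t by rewrite sqrtr_gt0.
  have tt : t ^+ 2 = sqn x by rewrite sqr_sqrtr // ltW.
  have sZ q (y : 'cV[R]_q) a : sqn (a *: y) = a ^+ 2 * sqn y by rewrite /sqn !bilE; ring.
  have := unit_bound (t^-1 *: x); rewrite -scalemxAr !sZ exprVn tt mulVf ?gt_eqF // => /(_ (lexx _)).
  by rewrite ler_pdivrMl // mulrC.
have : 0 <= sqn (X *m x - nu *: x) by exact: sqn_ge0.
rewrite /sqn !bilE -/(sqn x) -/(sqn (X *m x)) (bilC1 (X *m x) x) -bil_mulr mul1mx => h.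
have h2 : 2 * nu * bil X x x <= 2 * nu * (nu * sqn x) by lra.
by rewrite -(ler_pM2l (_ : 0 < 2 * nu)) //; lra.
Qed.

End PsdBounds.

(** * One change of gain *)

Section Step.
Context {R : realType} {m d l n : nat}.
Variables (A : 'M[R]_m) (B : 'M[R]_(m, d)) (C : 'M[R]_(l, m)) (D : 'M[R]_(m, n)).
Variables (Rw : 'M[R]_d) (gamma : R).
Hypothesis hRw : posdef Rw.
Hypothesis g0 : 0 < gamma.
Implicit Types (K : 'M[R]_(d, m)) (P : 'M[R]_m).

Local Notation g := (gamma ^- 2).

Definition riccati_op K P : 'M[R]_m :=
  (A - B *m K)^T *m P + P *m (A - B *m K) + state_cost C Rw K
    + gamma ^- 2 *: (P *m D *m D^T *m P).

Lemma riccati_opE K P (x : 'cV[R]_m) : P^T = P ->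
  bil (riccati_op K P) x x =
  2 * bil P x ((A - B *m K) *m x) + bil (state_cost C Rw K) x x + g * sqn (D^T *m P *m x).
Proof. exact: riccati_form. Qed.

Lemma gsqr_gt0 : 0 < g.
Proof. by rewrite invr_gt0 exprn_gt0. Qed.

(** The residual R K - B^T P is half the derivative of K |-> Ric_K(P), which is
    quadratic in K with second-order part R. *)
Lemma riccati_op_step K K' P (x : 'cV[R]_m) (z : 'cV[R]_d) :
  P^T = P -> riccati_op K P = 0 -> K' *m x = K *m x - z ->
  bil (riccati_op K' P) x x =
  - (2 * bil 1%:M z ((Rw *m K - B^T *m P) *m x)) + bil Rw z z.
Proof.
move=> sP ric eK; have sR : Rw^T = Rw := hRw.1.
have := bil0m x x; rewrite -ric !riccati_opE // !state_cost_form.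
have e F : bil P x ((A - B *m F) *m x) = bil P x (A *m x) - bil 1%:M (F *m x) (B^T *m P *m x).
  rewrite mulmxBl bilDr bilNr (bilC1 (F *m x)) bil1E !trmx_mul trmxK sP /bil !mulmxA.
  by [].
rewrite !e eK.
have -> : bil 1%:M z ((Rw *m K - B^T *m P) *m x) = bil Rw z (K *m x) - bil 1%:M z (B^T *m P *m x).
  by rewrite mulmxBl bilDr bilNr -(mulmxA Rw) -bil_mulr mul1mx.
rewrite !bilE (bil_sym z (K *m x) sR); lra.
Qed.

(** K' is the new gain, P the stabilizing solution for the old gain K; the Riccati
    inequality for K' at P is strict except where M vanishes, and there the gains
    agree. *)
Section NewGain.
Variables (K K' : 'M[R]_(d, m)) (P : 'M[R]_m) (M : 'M[R]_(d, m)) (c : R).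
Hypothesis hdet : detectable A C.
Hypothesis hP : stabilizing_solution A B C D Rw gamma K P.
Hypothesis c0 : 0 < c.
Hypothesis hM : forall x : 'cV[R]_m, bil (riccati_op K' P) x x <= - (c * sqn (M *m x)).
Hypothesis hK' : forall x : 'cV[R]_m, M *m x = 0 -> K' *m x = K *m x.

(** Evaluate the Riccati inequality at an eigenvector of A_K' whose eigenvalue has
    nonnegative real part: every term is nonnegative, so all vanish, in particular
    C v and K' v. Then v is an eigenvector of A - L C for the same eigenvalue. *)
Lemma new_gain_hurwitz : hurwitz (A - B *m K').
Proof.
have [[sP pP] _ _] := hP; have [L hL] := hdet; have [_ pR] := posdef_psd hRw.
apply/hurwitzP => al be a b al0 [ea eb].
have := hM a; have := hM b; rewrite !riccati_opE // !state_cost_form ea eb !bilE.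
rewrite (bil_sym b a sP).
have pa : 0 <= al * bil P a a by rewrite mulr_ge0 //; exact: pP.
have pb : 0 <= al * bil P b b by rewrite mulr_ge0 //; exact: pP.
have ra : 0 <= bil Rw (K' *m a) (K' *m a) by exact: pR.
have rb : 0 <= bil Rw (K' *m b) (K' *m b) by exact: pR.
have ga := mulr_ge0 (ltW gsqr_gt0) (sqn_ge0 (D^T *m P *m a)).
have gb := mulr_ge0 (ltW gsqr_gt0) (sqn_ge0 (D^T *m P *m b)).
have ma := mulr_ge0 (ltW c0) (sqn_ge0 (M *m a)).
have mb := mulr_ge0 (ltW c0) (sqn_ge0 (M *m b)).
have Ca := sqn_ge0 (C *m a); have Cb := sqn_ge0 (C *m b) => h1 h2.
have Rw0 y : bil Rw y y <= 0 -> y = 0.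
  move=> hy; apply/eqP; apply: contraT => nz; have := hRw.2 y nz.
  by rewrite -/(bil _ _ _) ltNge hy.
have Ka : K' *m a = 0 by apply: Rw0; lra.
have Kb : K' *m b = 0 by apply: Rw0; lra.
have Ca0 : C *m a = 0 by apply: sqn_eq0; lra.
have Cb0 : C *m b = 0 by apply: sqn_eq0; lra.
have eq x : K' *m x = 0 -> C *m x = 0 -> (A - L *m C) *m x = (A - B *m K') *m x.
  by move=> e1 e2; rewrite !mulmxBl -!mulmxA e1 e2 !mulmx0.
have /hurwitzP h := hL; apply: (h al be a b al0); split; rewrite eq //.
Qed.

(** For an eigenvector (x, y) at an imaginary eigenvalue, pairing the two block
    rows with y and x, and the first one with P x, gives
    Ric_K'(P)(x) = gamma^-2 |D^T (y - P x)|^2 >= 0. Hence M x = 0 and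
    D^T y = D^T P x, so x is an eigenvector of the old closed loop and vanishes;
    then y is an eigenvector of the Hurwitz matrix A_K'^T. *)
Lemma new_gain_no_imaginary :
  no_imaginary_eigenvalue
    (hamiltonian (A - B *m K') (gamma^-1 *: D *m (gamma^-1 *: D)^T) (state_cost C Rw K')).
Proof.
have [[sP pP] _ hG] := hP.
rewrite scaled_gram.
move=> w a b [].
rewrite -[a]vsubmxK -[b]vsubmxK.
set x1 := usubmx a; set y1 := dsubmx a; set x2 := usubmx b; set y2 := dsubmx b.
rewrite !mul_block_col !scale_col_mx opp_col_mx !add_col_mx !scale0r !add0r !addr0.
set F := A - B *m K'; set Q := state_cost C Rw K'.
move=> /eq_col_mx [e1 e2] /eq_col_mx [e3 e4].
pose N := g *: (D *m D^T); rewrite -/N in e1 e3.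
have sN : N^T = N by rewrite /N linearZ /= trmx_mul trmxK.
have NE (u v : 'cV[R]_m) : bil 1%:M u (N *m v) = g * bil 1%:M (D^T *m u) (D^T *m v).
  by rewrite !bil1E /N -scalemxAl -scalemxAr mxE trmx_mul trmxK !mulmxA.
pose dot := @bil R m m 1%:M.
have f1 : dot y1 (F *m x1) + dot y1 (N *m y1) = - (w * dot y1 x2).
  by rewrite /dot -bilDr e1 bilNr bilZr.
have f3 : dot y2 (F *m x2) + dot y2 (N *m y2) = w * dot y2 x1.
  by rewrite /dot -bilDr e3 bilZr.
have QE (x y : 'cV[R]_m) : dot x (- Q *m x + - F^T *m y) = - bil Q x x - dot y (F *m x).
  rewrite /dot !mulNmx bilDr !bilNr -!bil_mulr !mul1mx; congr (_ - _).
  by rewrite bil_tr.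
have f2 : - bil Q x1 x1 - dot y1 (F *m x1) = - (w * dot y2 x1).
  by rewrite -QE e2 /dot bilNr bilZr bilC1.
have f4 : - bil Q x2 x2 - dot y2 (F *m x2) = w * dot y1 x2.
  by rewrite -QE e4 /dot bilZr bilC1.
have PE (x v : 'cV[R]_m) : bil P x v = dot (P *m x) v.
  by rewrite /dot bil1E trmx_mul sP.
have f5 : bil P x1 (F *m x1) + dot (P *m x1) (N *m y1) = - (w * bil P x1 x2).
  by rewrite -PE -bilDr e1 bilNr bilZr.
have f6 : bil P x2 (F *m x2) + dot (P *m x2) (N *m y2) = w * bil P x1 x2.
  by rewrite -PE -bilDr e3 bilZr (bil_sym x2 x1 sP).
have := hM x1; have := hM x2; rewrite !riccati_opE // -/F -/Q.
have sq (x y : 'cV[R]_m) : g * sqn (D^T *m (y - P *m x)) =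
    dot y (N *m y) - 2 * dot (P *m x) (N *m y) + g * sqn (D^T *m P *m x).
  rewrite /dot !NE mulmxBr /sqn !bilE -!mulmxA (bilC1 (D^T *m y) (D^T *m (P *m x))); ring.
have s1 := sq x1 y1; have s2 := sq x2 y2.
have ma := mulr_ge0 (ltW c0) (sqn_ge0 (M *m x1)).
have mb := mulr_ge0 (ltW c0) (sqn_ge0 (M *m x2)).
have ga := mulr_ge0 (ltW gsqr_gt0) (sqn_ge0 (D^T *m (y1 - P *m x1))).
have gb := mulr_ge0 (ltW gsqr_gt0) (sqn_ge0 (D^T *m (y2 - P *m x2))).
move=> h2 h1.
have zero (k : R) q (v : 'cV[R]_q) : 0 < k -> k * sqn v <= 0 -> v = 0.
  by move=> k0 h; apply: sqn_eq0; rewrite -(pmulr_rle0 _ k0).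
have [i1 i2] : c * sqn (M *m x1) <= 0 /\ c * sqn (M *m x2) <= 0 by split; lra.
have [i3 i4] : g * sqn (D^T *m (y1 - P *m x1)) <= 0 /\ g * sqn (D^T *m (y2 - P *m x2)) <= 0.
  by split; lra.
have M1 := zero _ _ _ c0 i1; have M2 := zero _ _ _ c0 i2.
have D1 := zero _ _ _ gsqr_gt0 i3; have D2 := zero _ _ _ gsqr_gt0 i4.
have Gx (x y : 'cV[R]_m) : M *m x = 0 -> D^T *m (y - P *m x) = 0 ->
    (A - B *m K + g *: (D *m D^T *m P)) *m x = F *m x + N *m y.
  move=> Mx Dx; rewrite mulmxDl /F !mulmxBl -!mulmxA (hK' Mx) -/F /N -!scalemxAl -!mulmxA.
  congr (_ + g *: (D *m _)); apply/eqP; rewrite eq_sym -subr_eq0 -mulmxBr.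
  by rewrite Dx.
have [x10 x20] : x1 = 0 /\ x2 = 0.
  move/hurwitzP: hG => /(_ 0 w x1 x2 (lexx 0)); apply; split.
    by rewrite (Gx _ _ M1 D1) e1 scale0r add0r.
  by rewrite (Gx _ _ M2 D2) e3 scale0r addr0.
have [y10 y20] : y1 = 0 /\ y2 = 0.
  have /hurwitzP := hurwitz_trmx new_gain_hurwitz; rewrite -/F => /(_ 0 (- w) y1 y2 (lexx 0)).
  apply; split.
    move: e2; rewrite x10 mulmx0 add0r mulNmx => /eqP; rewrite eqr_opp => /eqP ->.
    by rewrite scale0r add0r scaleNr opprK.
  move: e4; rewrite x20 mulmx0 add0r mulNmx => /eqP; rewrite eqr_oppLR => /eqP ->.
  by rewrite scale0r addr0 scaleNr.
by rewrite x10 x20 y10 y20 col_mx0.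
Qed.

Lemma new_gain_stabilizing :
  stabilizing_solution A B C D Rw gamma K' (riccati_sol A B C D Rw gamma K').
Proof.
have [P' hP'] := stabilizing_of_no_imaginary hRw g0 new_gain_hurwitz new_gain_no_imaginary.
exact: (@xgetPex _ 0 [set P | stabilizing_solution A B C D Rw gamma K' P]%classic
  (ex_intro _ P' hP')).
Qed.

Lemma new_gain_feasible : feasible A B C D Rw gamma K'.
Proof.
split; first exact: new_gain_hurwitz.
exact: (hinf_norm_lt hRw g0 new_gain_hurwitz new_gain_stabilizing).
Qed.

(** Along the Hurwitz closed loop of K' the form of X = P - P_K' is nonincreasing:
    its derivative is at most - gamma^-2 |D^T X x|^2. *)
Lemma new_gain_decrease : possemidef (P - riccati_sol A B C D Rw gamma K').
Proof.
have [[sP pP] _ _] := hP.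
have [[sP' pP'] ric' hG'] := new_gain_stabilizing.
set P' := riccati_sol _ _ _ _ _ _ _ in sP' pP' ric' hG' *.
apply: (lyapunov_ge0 hG'); first by rewrite linearB /= sP sP'.
move=> x; have h1 := hM x; have h2 := bil0m x x.
rewrite -[X in bil X]ric' (riccati_opE K') // in h2; rewrite riccati_opE // in h1.
have ma := mulr_ge0 (ltW c0) (sqn_ge0 (M *m x)).
have := mulr_ge0 (ltW gsqr_gt0) (sqn_ge0 (D^T *m P *m x - D^T *m P' *m x)).
rewrite mulmxDl bilDr -scalemxAl bilZr !bilDm !bilNm.
have PE (X : 'M[R]_m) : X^T = X -> bil X x (D *m D^T *m P' *m x) = bil 1%:M (D^T *m X *m x) (D^T *m P' *m x).
  by move=> sX; rewrite bil1E !trmx_mul trmxK sX /bil !mulmxA.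
rewrite !PE // /sqn !bilE (bilC1 (D^T *m P' *m x)).
rewrite /sqn in h1 h2 ma.
lra.
Qed.

End NewGain.

End Step.

(** * Bounds along the iteration *)

Section Rate.
Context {R : realType} {m d l n : nat}.
Variables (A : 'M[R]_m) (B : 'M[R]_(m, d)) (C : 'M[R]_(l, m)) (D : 'M[R]_(m, n)).
Variables (Rw : 'M[R]_d) (gamma : R).
Hypothesis hRw : posdef Rw.
Hypothesis g0 : 0 < gamma.
Implicit Types (K : 'M[R]_(d, m)) (P : 'M[R]_m).

Local Notation g := (gamma ^- 2).
Local Notation ric := (riccati_op A B C D Rw gamma).

(** In the Riccati equation the term K^T R K is quadratic in K, and the only other
    term containing K is linear in it. *)
Lemma gain_bounded (p : R) : exists k : R, forall K P,
  stabilizing_solution A B C D Rw gamma K P -> nrm P <= p -> nrm K <= k.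
Proof.
have [r r0 hr] := posdef_lower hRw.
pose q := nrm B * p.
pose k0 := 2 / r * (2 * (p * nrm A) + 2 / r * (q * q)).
exists (d%:R * m%:R * (1 + k0)) => K P [[sP pP] ricK _] hp.
have p0 : 0 <= p := le_trans (nrm_ge0 P) hp.
have entry i j : `|K i j| <= 1 + k0.
  pose x : 'cV[R]_m := delta_mx j ord0.
  have x1 : sqn x = 1 := sqn_delta j.
  have := riccati_opE A B C D Rw gamma K x sP; rewrite /riccati_op ricK bil0m.
  have [_ pQ] := state_cost_psd C hRw K; rewrite state_cost_form.
  have gx := mulr_ge0 (ltW (gsqr_gt0 g0)) (sqn_ge0 (D^T *m P *m x)).
  have cx := sqn_ge0 (C *m x).
  have kx := hr (K *m x).
  have -> : bil P x ((A - B *m K) *m x) = bil (P *m A) x x - bil 1%:M (B^T *m P *m x) (K *m x).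
    by rewrite mulmxBl bilDr bilNr bil_mulr bil1E !trmx_mul trmxK sP /bil !mulmxA.
  have := bil_bound (P *m A) x; rewrite x1 mulr1 ler_norml => /andP[a1 _].
  have a2 : nrm (P *m A) <= p * nrm A.
    by apply: le_trans (nrmM _ _) _; rewrite ler_wpM2r ?nrm_ge0.
  have b0 : nrm (B^T *m P) <= q.
    by apply: le_trans (nrmM _ _) _; rewrite nrm_tr ler_wpM2l ?nrm_ge0.
  have b1 : sqn (B^T *m P *m x) <= q * q.
    apply: le_trans (sqn_mul_bound _ _) _; rewrite x1 mulr1.
    by apply: le_trans (nrmM _ _) _; rewrite nrm_tr ler_pM ?nrm_ge0.
  have ri : r * r^-1 = 1 by rewrite divff // gt_eqF.
  have ri0 : 0 < r^-1 by rewrite invr_gt0.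
  have r2 : 0 <= 2 / r by rewrite divr_ge0 // ltW.
  have := sqn_ge0 (K *m x - (2 / r) *: (B^T *m P *m x)).
  have -> : sqn (K *m x - (2 / r) *: (B^T *m P *m x)) = sqn (K *m x) -
      4 / r * bil 1%:M (B^T *m P *m x) (K *m x) + 2 / r * (2 / r * sqn (B^T *m P *m x)).
    by rewrite /sqn !bilE (bilC1 (K *m x)); ring.
  have b2 : 2 / r * (2 / r * sqn (B^T *m P *m x)) <= 2 / r * (2 / r * (q * q)).
    by rewrite !(ler_wpM2l r2).
  move=> h1 h2.
  have h3 : 2 / r * (r * sqn (K *m x)) <=
      2 / r * (2 * bil 1%:M (B^T *m P *m x) (K *m x) + 2 * (p * nrm A)).
    by rewrite (ler_wpM2l r2) //; lra.
  have h4 : 2 / r * (r * sqn (K *m x)) = 2 * sqn (K *m x).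
    have -> : 2 / r * (r * sqn (K *m x)) = r * r^-1 * (2 * sqn (K *m x)) by ring.
    by rewrite ri mul1r.
  have hs : sqn (K *m x) <= k0 by rewrite /k0; lra.
  have := sqn_entry (K *m x) i; have -> : (K *m x) i ord0 = K i j by rewrite -colE mxE.
  rewrite -[K i j ^+ 2]real_normK ?num_real // => h5.
  have := sqr_ge0 (1 - `|K i j|); have := sqr_ge0 `|K i j|; lra.
apply: (@le_trans _ _ (\sum_(i < d) \sum_(j < m) (1 + k0))).
  by apply: ler_sum => i _; apply: ler_sum => j _.
by rewrite !sumr_const !card_ord -mulrnA -[_ *+ (m * d)]mulr_natl natrM (mulrC m%:R).
Qed.

(** P N P - P' N P' = X N P + P' N X for X = P - P', so the difference of the two
    Riccati operators is linear in X once P and P' are taken as coefficients. *)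
Lemma trace_riccati_bound K' P P' : P^T = P -> P'^T = P' -> ric K' P' = 0 ->
  possemidef (P - P') ->
  - \tr (ric K' P) <=
    nrm ((A - B *m K')^T + (A - B *m K') + g *: (D *m D^T *m P) + g *: (P' *m D *m D^T))
      * \tr (P - P').
Proof.
move=> sP sP' ricP' pX.
set F := A - B *m K'; set X := P - P' in pX *.
have e : ric K' P = F^T *m X + X *m F + g *: (X *m (D *m D^T *m P) + P' *m D *m D^T *m X).
  rewrite -[LHS]subr0 -ricP' /riccati_op -/F /X !(mulmxBl, mulmxBr, mulmxA).
  by apply/matrixP => i j; rewrite !mxlinE; ring.
clearbody X F.
have {e} -> : \tr (ric K' P) =
    \tr (X *m (F^T + F + g *: (D *m D^T *m P) + g *: (P' *m D *m D^T))).
  rewrite e !mulmxDr -!scalemxAr !(mxtraceD, mxtraceZ) (mxtrace_mulC F^T).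
  by rewrite (mxtrace_mulC (P' *m D *m D^T)); ring.
apply: le_trans (ler_norm _) _.
by rewrite normrN psd_trace_mul.
Qed.

(** Here the step is Z = 2 eta M, and eta nu <= 1/2 makes the quadratic term at
    most half of the linear one. *)
Lemma natural_gradient_descent K P (eta nu : R) (x : 'cV[R]_m) :
  P^T = P -> ric K P = 0 -> 0 < eta -> 2 * (eta * nu) <= 1 ->
  (forall y, bil Rw y y <= nu * sqn y) ->
  bil (ric (K - (2 * eta) *: (Rw *m K - B^T *m P)) P) x x <=
    - (2 * eta * sqn ((Rw *m K - B^T *m P) *m x)).
Proof.
move=> sP ricK e0 he hnu; set M := Rw *m K - B^T *m P.
have step : (K - (2 * eta) *: M) *m x = K *m x - (2 * eta) *: (M *m x).
  by rewrite mulmxBl scalemxAl.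
rewrite (riccati_op_step hRw sP ricK step) -/M.
rewrite !bilE -/(sqn (M *m x)); have h := hnu (M *m x); have s0 := sqn_ge0 (M *m x).
have h1 : (2 * eta) ^+ 2 * bil Rw (M *m x) (M *m x) <= (2 * eta) ^+ 2 * (nu * sqn (M *m x)).
  by rewrite ler_wpM2l ?sqr_ge0.
have h2 : 2 * eta * (2 * (eta * nu)) * sqn (M *m x) <= 2 * eta * 1 * sqn (M *m x).
  by rewrite ler_wpM2r // ler_wpM2l // mulr_ge0 // ltW.
lra.
Qed.

(** Here the step is Z = 2 eta y with R y = M x, so both terms are multiples of
    y^T R y, which [psd_image_bound] compares with |M x|^2. *)
Lemma gauss_newton_descent K P (eta k : R) (x : 'cV[R]_m) :
  P^T = P -> ric K P = 0 -> 0 < eta -> eta <= 1 / 2 -> 0 < k ->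
  (forall y, bil Rw y y <= k * sqn y) ->
  bil (ric (K - (2 * eta) *: (K - invmx Rw *m B^T *m P)) P) x x <=
    - (2 * eta / k * sqn ((Rw *m K - B^T *m P) *m x)).
Proof.
move=> sP ricK e0 he k0 hk.
have uR := posdef_unit hRw.
pose y := (K - invmx Rw *m B^T *m P) *m x.
have My : (Rw *m K - B^T *m P) *m x = Rw *m y.
  by rewrite /y mulmxA mulmxBr -!mulmxA mulKVmx.
have step : (K - (2 * eta) *: (K - invmx Rw *m B^T *m P)) *m x = K *m x - (2 * eta) *: y.
  by rewrite mulmxBl -scalemxAl.
rewrite (riccati_op_step hRw sP ricK step) My.
have h := psd_image_bound (posdef_psd hRw) k0 hk y.
rewrite !bilE -bil_mulr mul1mx.
have p0 : 0 <= bil Rw y y by exact: (posdef_psd hRw).2.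
have h1 : 2 * eta / k * sqn (Rw *m y) <= 2 * eta * bil Rw y y.
  by rewrite -mulrA ler_wpM2l ?mulr_ge0 ?(ltW e0) // ler_pdivrMl.
have h2 : eta * (4 * eta * bil Rw y y) <= 1 / 2 * (4 * eta * bil Rw y y).
  by rewrite ler_wpM2r // !mulr_ge0 // ltW.
lra.
Qed.

End Rate.

(** * Convergence rate *)

Section Convergence.
Context {R : realType} {m d l n : nat}.
Variables (A : 'M[R]_m) (B : 'M[R]_(m, d)) (C : 'M[R]_(l, m)) (D : 'M[R]_(m, n)).
Variables (Rw : 'M[R]_d) (gamma : R).
Hypothesis hRw : posdef Rw.
Hypothesis g0 : 0 < gamma.
Implicit Types (K : 'M[R]_(d, m)).

Local Notation feas := (feasible A B C D Rw gamma).
Local Notation sol := (riccati_sol A B C D Rw gamma).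
Local Notation res := (residual A B C D Rw gamma).

Definition descent_step (c : R) K K' : Prop :=
  (forall x : 'cV[R]_m,
     bil (riccati_op A B C D Rw gamma K' (sol K)) x x <= - (c * sqn (res K *m x))) /\
  (forall x : 'cV[R]_m, res K *m x = 0 -> K' *m x = K *m x).

Lemma natural_gradient_descent_step (eta : R) K : 0 < eta ->
  eta <= 1 / (2 * fine (op_norm Rw)) -> feas K ->
  descent_step (2 * eta) K (natural_gradient_step A B C D Rw gamma eta K).
Proof.
move=> e0 he hK; have [[sP _] ric _] := feasible_stabilizing hRw g0 hK.
set nu := fine (op_norm Rw) in he.
have nu0 : 0 < nu.
  rewrite ltNge; apply/negP => nu0; have : 1 / (2 * nu) <= 0.
    by rewrite mul1r invr_le0; lra.
  lra.
have he2 : 2 * (eta * nu) <= 1 by move: he; rewrite ler_pdivlMr ?mulr_gt0 //; lra.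
split=> x; first by apply: natural_gradient_descent (op_norm_form (posdef_psd hRw) nu0).
by move=> h; rewrite /natural_gradient_step mulmxBl -scalemxAl -/(res K) h scaler0 subr0.
Qed.

Lemma gauss_newton_descent_step (eta : R) K : 0 < eta -> eta <= 1 / 2 -> feas K ->
  descent_step (2 * eta / (nrm Rw + 1)) K (gauss_newton_step A B C D Rw gamma eta K).
Proof.
move=> e0 he hK; have [[sP _] ric _] := feasible_stabilizing hRw g0 hK.
have k0 : 0 < nrm Rw + 1 by have := nrm_ge0 Rw; lra.
split=> x.
  apply: gauss_newton_descent => // y.
  have := bil_bound Rw y; have := sqn_ge0 y; rewrite ler_norml => h /andP[_]; lra.
move=> h; rewrite /gauss_newton_step mulmxBl -scalemxAl.
have -> : K - invmx Rw *m B^T *m sol K = invmx Rw *m res K.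
  by rewrite /residual mulmxBr mulKmx ?posdef_unit // !mulmxA.
by rewrite -mulmxA h mulmx0 scaler0 subr0.
Qed.

(** [trace_riccati_bound] with its coefficient bounded in terms of p and
    of the data. *)
Lemma residual_decrease (p c : R) : exists b : R, forall K K',
  feas K' -> stabilizing_solution A B C D Rw gamma K (sol K) -> descent_step c K K' ->
  possemidef (sol K - sol K') -> nrm (sol K) <= p -> nrm (sol K') <= p ->
  c * frob_norm (res K) ^+ 2 <= b * \tr (sol K - sol K').
Proof.
have twice (u v t : R) : u <= v -> u + u + t + t <= 2 * v + 2 * t by lra.
have [k hk] := gain_bounded A B C D hRw g0 p.
pose g := gamma ^- 2; have gg0 : 0 < g := gsqr_gt0 g0.
exists (2 * (nrm A + nrm B * k) + 2 * (g * (nrm (D *m D^T) * p))) => K K' hK' hP [hd _] pX pP pP'.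
have [[sP _] _ _] := hP; have st' := feasible_stabilizing hRw g0 hK'.
have [[sP' _] ric' _] := st'; have kK' := hk _ _ st' pP'.
apply: (@le_trans _ _ (- \tr (riccati_op A B C D Rw gamma K' (sol K)))).
  rewrite trace_bil frob_sqr mulr_sumr -sumrN; apply: ler_sum => j _.
  by rewrite lerNr.
apply: le_trans (trace_riccati_bound sP sP' ric' pX) _.
rewrite ler_wpM2r ?psd_trace_ge0 //.
have nF : nrm (A - B *m K') <= nrm A + nrm B * k.
  apply: le_trans (nrmD _ _) _; rewrite nrmN lerD2l.
  by apply: le_trans (nrmM _ _) _; rewrite ler_wpM2l ?nrm_ge0.
have n1 : nrm (g *: (D *m D^T *m sol K)) <= g * (nrm (D *m D^T) * p).
  rewrite nrmZ gtr0_norm //; apply: ler_wpM2l; first exact: ltW.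
  apply: (le_trans (nrmM _ _)); apply: ler_wpM2l; [exact: nrm_ge0|exact: pP].
have n2 : nrm (g *: (sol K' *m D *m D^T)) <= g * (nrm (D *m D^T) * p).
  rewrite nrmZ gtr0_norm // -mulmxA; apply: ler_wpM2l; first exact: ltW.
  apply: (le_trans (nrmM _ _)); rewrite mulrC.
  apply: ler_wpM2l; [exact: nrm_ge0|exact: pP'].
have h := nrmD (A - B *m K')^T (A - B *m K'); rewrite nrm_tr in h.
apply: le_trans (nrmD _ _) _; apply: le_trans (lerD (nrmD _ _) n2) _.
apply: le_trans (twice _ _ _ nF); rewrite lerD2r; exact: lerD.
Qed.

Lemma sum_decrements (f : nat -> R) N :
  \sum_(k < N) (f k - f k.+1) = f 0%N - f N.
Proof.
elim: N => [|N IH]; first by rewrite big_ord0 subrr.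
by rewrite big_ord_recr /= IH addrA subrK.
Qed.

Lemma descent_sequence_rate (c : R) (K : nat -> 'M[R]_(d, m)) :
  detectable A C -> 0 < c -> feas (K 0%N) ->
  (forall k, feas (K k) -> descent_step c (K k) (K k.+1)) ->
  (forall k, feas (K k)) /\
  exists b : R, forall N : nat, \sum_(k < N) frob_norm (res (K k)) ^+ 2 <= b.
Proof.
move=> hdet c0 hK0 hstep.
have hf k : feas (K k).
  elim: k => [|k IH]; first exact: hK0.
  have [h1 h2] := hstep _ IH.
  exact: (new_gain_feasible hRw g0 hdet (feasible_stabilizing hRw g0 IH) c0 h1 h2).
split; first exact: hf.
have st k := feasible_stabilizing hRw g0 (hf k).
have dec k : possemidef (sol (K k) - sol (K k.+1)).
  have [h1 h2] := hstep _ (hf k).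
  exact: (new_gain_decrease hRw g0 hdet (st k) c0 h1 h2).
have psd k : possemidef (sol (K k)) by case: (st k).
have tr_dec k : \tr (sol (K k)) <= \tr (sol (K 0%N)).
  elim: k => [|k]; [exact: lexx|apply: le_trans].
  by have := psd_trace_ge0 (dec k); rewrite raddfB subr_ge0.
(* the solutions decrease, so one bound serves for all of them *)
pose p := m%:R * m%:R * \tr (sol (K 0%N)).
have hp k : nrm (sol (K k)) <= p.
  apply: le_trans (psd_nrm (psd k)) _.
  by rewrite ler_wpM2l ?mulr_ge0 ?ler0n.
have [b hb] := residual_decrease p c.
exists (`|b| / c * \tr (sol (K 0%N))) => N.
have tele : \sum_(k < N) \tr (sol (K k) - sol (K k.+1)) = \tr (sol (K 0%N)) - \tr (sol (K N)).
  rewrite (eq_bigr (fun k : 'I_N => \tr (sol (K k)) - \tr (sol (K k.+1)))); last first.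
    by move=> k _; rewrite raddfB.
  exact: (sum_decrements (fun k => \tr (sol (K k)))).
apply: (@le_trans _ _ (\sum_(k < N) `|b| / c * \tr (sol (K k) - sol (K k.+1)))).
  apply: ler_sum => k _; rewrite mulrAC ler_pdivlMr // mulrC.
  apply: le_trans (hb _ _ (hf k.+1) (st k) (hstep _ (hf k)) (dec k) (hp k) (hp k.+1)) _.
  by rewrite ler_wpM2r ?ler_norm ?psd_trace_ge0.
rewrite -mulr_sumr tele ler_wpM2l ?divr_ge0 ?(ltW c0) //.
by rewrite gerBl psd_trace_ge0.
Qed.

End Convergence.

Theorem theoremA7 (R : realType) (m d l n : nat)
    (A : 'M[R]_m) (B : 'M[R]_(m, d)) (C : 'M[R]_(l, m)) (D : 'M[R]_(m, n))
    (E : 'M[R]_(l, d)) (Rw : 'M[R]_d) (gamma : R)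
    (hRw : posdef Rw)
    (hE : E^T *m row_mx C E = row_mx 0 Rw)
    (hgamma : 0 < gamma)
    (Kstar : 'M[R]_(d, m))
    (hopt : global_optimum A B C D Rw gamma Kstar)
    (hform : Kstar = invmx Rw *m B^T *m riccati_sol A B C D Rw gamma Kstar)
    (K0 : 'M[R]_(d, m))
    (hK0 : feasible A B C D Rw gamma K0)
    (hK0fin : (op_norm K0 < +oo)%E)
    (hdet : detectable A C)
    (eta : R) (heta : 0 < eta)
    (K : nat -> 'M[R]_(d, m))
    (hKinit : K 0%N = K0)
    (hKstep :
      (eta <= 1 / (2 * fine (op_norm Rw)) /\
        forall k : nat,
          K k.+1 = natural_gradient_step A B C D Rw gamma eta (K k))
      \/
      (eta <= 1 / 2 /\
        forall k : nat,
          K k.+1 = gauss_newton_step A B C D Rw gamma eta (K k))) :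
  (forall k : nat, feasible A B C D Rw gamma (K k)) /\
  exists c : R, forall N : nat, (1 <= N)%N ->
    N%:R^-1 * (\sum_(k < N) frob_norm (residual A B C D Rw gamma (K k)) ^+ 2)
      <= c / N%:R.
Proof.
have [c c0 hc] : exists2 c : R, 0 < c & forall k,
    feasible A B C D Rw gamma (K k) -> descent_step A B C D Rw gamma c (K k) (K k.+1).
  case: hKstep => -[he hK].
    exists (2 * eta) => [|k hk]; first by rewrite mulr_gt0.
    by rewrite hK; exact: natural_gradient_descent_step.
  exists (2 * eta / (nrm Rw + 1)) => [|k hk].
    by rewrite divr_gt0 ?mulr_gt0 // ltr_wpDl ?nrm_ge0.
  by rewrite hK; exact: gauss_newton_descent_step.
rewrite -hKinit in hK0.
have [hf [b hb]] := descent_sequence_rate hRw hgamma hdet c0 hK0 hc.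
split; first exact: hf.
exists b => N N0.
rewrite mulrC; apply: ler_wpM2r; [by rewrite invr_ge0 ler0n|exact: hb].
Qed.
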